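(* Let $\Gamma$ be a compact metric graph, $\kappa,\tau>0$, and let $u$ be the solution of $(\kappa^2-\Delta_\Gamma)^{\alpha/2}(\tau u)=\mathcal W$ on $\Gamma$ with $\alpha=1$. Let $s_1,\dots,s_n\in\Gamma$ be distinct locations and $\mathbf U_{\mathbf s}=(u(s_1),\dots,u(s_n))^\top$. Then $\mathbf U_{\mathbf s}\sim\mathsf N(\mathbf 0,\mathbf Q_{\mathbf s}^{-1})$, where $$\mathbf Q_{\mathbf s}=\mathbf Q_{\mathbf{ss}}-\mathbf Q_{\mathbf{sv}}\mathbf Q_{\mathbf{vv}}^{-1}\mathbf Q_{\mathbf{vs}}$$ and $\bar{\mathbf Q}=\begin{bmatrix}\mathbf Q_{\mathbf{vv}}&\mathbf Q_{\mathbf{vs}}\\ \mathbf Q_{\mathbf{sv}}&\mathbf Q_{\mathbf{ss}}\end{bmatrix}$ is the vertex precision matrix of the extended graph $\bar\Gamma$ in which $s_1,\dots,s_n$ are added as vertices.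
   Context: Compact metric graph: $\Gamma$ consists of a finite set $\mathcal V$ of vertices and a finite set $\mathcal E$ of edges; each edge $e$ is identified by arc length with $[0,\ell_e]$, $0<\ell_e<\infty$, whose endpoints $t=0$, $t=\ell_e$ are vertices $\underline e,\bar e$ (loops, i.e. $\underline e=\bar e$, and multiple edges are allowed). $\Gamma$ is connected. $f_e$ is the restriction of $f$ to $e$; $\mathcal E_v$ is the set of edges incident to $v$. $L_2(\Gamma)=\bigoplus_{e}L_2(e)$; $C(\Gamma)$ is the space of continuous functions. Kirchhoff--Laplacian: for an edge $e$ incident to $v$, $\partial_e f(v)$ is the derivative of $f_e$ at $v$ directed away from $v$ ($f_e'(0)$ at $\underline e$, $-f_e'(\ell_e)$ at $\bar e$; a loop contributes both ends to vertex sums). $\Delta_\Gamma$ has domain $\{f\in C(\Gamma): f_e\in H^2(e)\ \forall e,\ \sum_{e\in\mathcal E_v}\partial_e f(v)=0\ \forall v\in\mathcal V\}$ and acts as $(\Delta_\Gamma f)_e=f_e''$. $L=\kappa^2-\Delta_\Gamma$ is self-adjoint, strictly positive, with discrete spectrum; powers are defined spectrally. Solution $u$ ($\alpha=1$): $\mathcal W$ is Gaussian white noise on $L_2(\Gamma)$ (centered Gaussian family with $\mathbb E[\mathcal W(h)\mathcal W(g)]=(h,g)_{L_2(\Gamma)}$), and $u$ is the centered Gaussian field with $(u,\psi)_{L_2(\Gamma)}=\mathcal W(\tau^{-1}L^{-1/2}\psi)$ a.s. for all $\psi\in L_2(\Gamma)$, in its continuous modification. Extended graph: $\bar\Gamma$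 is $\Gamma$ with the locations $s_1,\dots,s_n$ added as vertices (no duplication if $s_i\in\mathcal V$) and the edges containing them subdivided; $\bar{\mathcal V},\bar{\mathcal E}$ are its vertex and edge sets. $\mathbf v=(v_1,\dots,v_m)$, $m=|\bar{\mathcal V}|-n$, lists the vertices of $\bar\Gamma$ not among $\mathbf s=(s_1,\dots,s_n)$. With vertices of $\bar\Gamma$ ordered as $(\mathbf v,\mathbf s)$ and $w_i$ the $i$-th of them, and with $\mathcal E_{w}$ now the edges of $\bar\Gamma$ incident to $w$, the matrix $\bar{\mathbf Q}$ has entries $\bar Q_{ii}=2\kappa\tau^2\sum_{e\in\mathcal E_{w_i}}\big[\big(\tfrac12+\tfrac{e^{-2\kappa\ell_e}}{1-e^{-2\kappa\ell_e}}\big)\mathbb I(\bar e\ne\underline e)+\tanh(\kappa\ell_e/2)\mathbb I(\bar e=\underline e)\big]$ (each loop appearing once) and $\bar Q_{ij}=-2\kappa\tau^2\sum_{e\in\mathcal E_{w_i}\cap\mathcal E_{w_j}}\tfrac{e^{-\kappa\ell_e}}{1-e^{-2\kappa\ell_e}}$ for $i\ne j$. If $m=0$, $\mathbf Q_{\mathbf s}=\mathbf Q_{\mathbf{ss}}$. *)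

(* Defs.v *)
From mathcomp Require Export all_boot all_order all_algebra.
From mathcomp Require Export all_classical all_reals all_analysis.
Set Implicit Arguments.
Unset Strict Implicit.
Unset Printing Implicit Defensive.
Export Order.TTheory GRing.Theory Num.Theory.
Export numFieldNormedType.Exports.
Local Open Scope classical_set_scope.
Local Open Scope ring_scope.

(* The edge [e] is the interval [0, glen e], with the endpoint 0 glued to
   [gsrc e] and the endpoint [glen e] glued to [gtgt e]; loops and multiple
   edges are allowed. *)
Record metric_graph (R : realType) := MetricGraph {
  gvert : finType;
  gedge : finType;
  gsrc : gedge -> gvert;
  gtgt : gedge -> gvert;
  glen : gedge -> R }.

Definition adjacent (R : realType) (G : metric_graph R) : rel (gvert G) :=
  fun x y => [exists e : gedge G,
    (gsrc e == x) && (gtgt e == y) || (gsrc e == y) && (gtgt e == x)].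

(* A graph reduced to isolated vertices has no metric structure, so at least
   one edge is required. *)
Definition compact_metric_graph (R : realType) (G : metric_graph R) : Prop :=
  [/\ (0 < #|gedge G|)%N,
      forall e : gedge G, 0 < glen e
    & forall x y : gvert G, connect (@adjacent R G) x y].

(* The points of the graph, after the gluing: the vertices, and the pairs
   (e, t) with 0 < t < glen e. *)
Definition interior_point (R : realType) (G : metric_graph R) :=
  {p : gedge G * R | 0 < p.2 < glen p.1}.

Definition point (R : realType) (G : metric_graph R) : Type :=
  (gvert G + interior_point G)%type.

(* The point at position t of the edge e; t < 0 is read as 0 and t > glen e
   as glen e. *)
Definition pt (R : realType) (G : metric_graph R) (e : gedge G) (t : R) :
    point G :=
  if insub (e, t) is Some p then inr p
  else inl (if t <= 0 then gsrc e else gtgt e).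

Definition restr (R : realType) (G : metric_graph R) (f : point G -> R) :
    gedge G -> R -> R :=
  fun e t => f (pt e t).

(* Continuity for the quotient topology of the disjoint union of the edges. *)
Definition graph_continuous (R : realType) (G : metric_graph R)
    (f : point G -> R) : Prop :=
  forall e : gedge G, {within `[0, glen e], continuous (restr f e)}.

(* Elements of L_2 are given by representatives, edge by edge. *)

Definition L2_itv (R : realType) (l : R) (h : R -> R) : Prop :=
  measurable_fun `[0, l] h /\
  (@lebesgue_measure R).-integrable `[0, l] (fun t => ((h t) ^+ 2)%:E).

Definition L2 (R : realType) (G : metric_graph R) (h : gedge G -> R -> R) :
    Prop :=
  forall e, L2_itv (glen e) (h e).

Definition L2_eq (R : realType) (G : metric_graph R)
    (h g : gedge G -> R -> R) : Prop :=
  forall e, {ae (@lebesgue_measure R),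
    forall t, `[0, glen e]%classic t -> h e t = g e t}.

Definition L2_inner (R : realType) (G : metric_graph R)
    (h g : gedge G -> R -> R) : R :=
  \sum_e \int[@lebesgue_measure R]_(t in `[0, glen e]) (h e t * g e t).

(* [sobolev_H1 l f f'] : f is in H^1(0, l), is its own absolutely continuous
   representative, and has weak derivative f'. *)
Definition sobolev_H1 (R : realType) (l : R) (f f' : R -> R) : Prop :=
  [/\ L2_itv l f, L2_itv l f' &
      forall t : R, 0 <= t <= l ->
        f t = f 0 + \int[@lebesgue_measure R]_(x in `[0, t]) f' x].

(* Here f' is itself absolutely continuous, hence it is the classical
   derivative of f, one-sided at 0 and l. *)
Definition sobolev_H2 (R : realType) (l : R) (f f' f'' : R -> R) : Prop :=
  sobolev_H1 l f f' /\ sobolev_H1 l f' f''.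

(* [kirchhoff_laplacian f g] : f belongs to the domain and its image is g. *)
Definition kirchhoff_laplacian (R : realType) (G : metric_graph R)
    (f : point G -> R) (g : gedge G -> R -> R) : Prop :=
  graph_continuous f /\
  exists f' : gedge G -> R -> R,
    (forall e, sobolev_H2 (glen e) (restr f e) (f' e) (g e)) /\
    (forall v : gvert G,
       \sum_(e | gsrc e == v) f' e 0 + \sum_(e | gtgt e == v) - f' e (glen e)
       = 0).

Definition whittle_op (R : realType) (G : metric_graph R) (kappa : R)
    (f : point G -> R) (h : gedge G -> R -> R) : Prop :=
  exists2 g, kirchhoff_laplacian f g &
    L2_eq h (fun e t => kappa ^+ 2 * restr f e t - g e t).

Definition spectral_decomposition (R : realType) (G : metric_graph R)
    (kappa : R) (lam : nat -> R) (phi : nat -> point G -> R) : Prop :=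
  [/\ forall k, whittle_op kappa (phi k) (fun e t => lam k * restr (phi k) e t),
      forall j k, L2_inner (restr (phi j)) (restr (phi k)) = (j == k)%:R
    & forall h : gedge G -> R -> R, L2 h ->
        (forall k, L2_inner h (restr (phi k)) = 0) ->
        L2_eq h (fun _ _ => 0)].

(* [whittle_pow kappa a psi f] : f = L^a psi, i.e. f is the sum in L_2 of
   lam_k^a (psi, phi_k) phi_k for an orthonormal eigenbasis (phi_k). *)
Definition whittle_pow (R : realType) (G : metric_graph R) (kappa a : R)
    (psi f : gedge G -> R -> R) : Prop :=
  exists lam phi, [/\ @spectral_decomposition R G kappa lam phi, L2 f &
    (fun N : nat =>
       let r : gedge G -> R -> R := fun e t => f e t -
         \sum_(k < N) lam k `^ a * L2_inner psi (restr (phi k))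
                      * restr (phi k) e t in
       L2_inner r r) @ \oo --> 0].

(* The normal law with mean m and variance v; it is degenerate when v = 0. *)
Definition normal_law (R : realType) (m v : R) (A : set R) : \bar R :=
  if v == 0 then (\d_m A)%E else normal_prob m (Num.sqrt v) A.

Definition gaussian (R : realType) (d : measure_display)
    (T : measurableType d) (P : probability T R) (X : T -> R) (m v : R) :
    Prop :=
  [/\ measurable_fun setT X, 0 <= v &
      forall A : set R, measurable A -> P (X @^-1` A) = normal_law m v A].

(* X = (X_0, ..., X_(n-1)) has law N(mu, Sigma). *)
Definition gaussian_vector (R : realType) (d : measure_display)
    (T : measurableType d) (P : probability T R) (n : nat)
    (X : 'I_n -> T -> R) (mu : 'cV[R]_n) (Sigma : 'M[R]_n) : Prop :=
  Sigma^T = Sigma /\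
  forall a : 'cV[R]_n,
    gaussian P (fun om => \sum_i a i 0 * X i om)
      ((a^T *m mu) 0 0) ((a^T *m Sigma *m a) 0 0).

Definition centered_gaussian_family (R : realType) (d : measure_display)
    (T : measurableType d) (P : probability T R) (I : Type) (D : set I)
    (X : I -> T -> R) : Prop :=
  forall (n : nat) (i : 'I_n -> I), (forall k, D (i k)) ->
    exists Sigma : 'M[R]_n, gaussian_vector P (fun k => X (i k)) 0 Sigma.

Definition white_noise (R : realType) (G : metric_graph R)
    (d : measure_display) (T : measurableType d) (P : probability T R)
    (W : (gedge G -> R -> R) -> T -> R) : Prop :=
  centered_gaussian_family P [set h | L2 h] W /\
  forall h g : gedge G -> R -> R, L2 h -> L2 g ->
    ('E_P[(fun om => W h om * W g om)%R] = (L2_inner h g)%:E)%E.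

(* u solves L^(alpha/2) (tau u) = W with alpha = 1. *)
Definition whittle_matern_solution (R : realType) (G : metric_graph R)
    (kappa tau : R) (d : measure_display) (T : measurableType d)
    (P : probability T R) (W : (gedge G -> R -> R) -> T -> R)
    (u : point G -> T -> R) : Prop :=
  [/\ centered_gaussian_family P setT u,
      {ae P, forall om, graph_continuous (fun x => u x om)}
    & forall psi : gedge G -> R -> R, L2 psi ->
        exists2 f, whittle_pow kappa (- 2^-1) psi f &
          {ae P, forall om, L2_inner (restr (fun x => u x om)) psi
                            = W (fun e t => tau^-1 * f e t) om}].

Section ExtendedGraph.
Variables (R : realType) (G : metric_graph R) (n : nat) (s : 'I_n -> point G).

Definition ext_points : seq (point G) :=
  [seq (inl v : point G) | v <- enum (gvert G)] ++ codom s.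

Definition position (e : gedge G) (x : point G) : option R :=
  if x is inr p then if (val p).1 == e then Some (val p).2 else None
  else None.

(* The positions of the added vertices inside the edge e, increasingly. *)
Definition cuts (e : gedge G) : seq R :=
  sort <=%R (undup (pmap (position e) (codom s))).

Definition breakpoint (e : gedge G) (j : nat) : R :=
  nth 0 (0 :: rcons (cuts e) (glen e)) j.

Lemma mem_breakpoint (e : gedge G) (j : nat) :
  pt e (breakpoint e j) \in ext_points.
Proof.
have mv v : (inl v : point G) \in ext_points.
  by rewrite mem_cat map_f ?mem_enum.
have [|] := ltnP j (size (0 :: rcons (cuts e) (glen e))); last first.
  move=> h; rewrite /breakpoint nth_default // /pt; case: insubP => [p|_].
    by rewrite /= ltxx.
  exact: mv.
move=> /(mem_nth 0); rewrite -/(breakpoint e j).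
rewrite inE mem_rcons inE => /or3P[/eqP->|/eqP->|].
- rewrite /pt; case: insubP => [p|_]; [by rewrite /= ltxx|exact: mv].
- rewrite /pt; case: insubP => [p|_]; [by rewrite /= ltxx andbF|exact: mv].
rewrite mem_sort mem_undup mem_pmap => /mapP[x xs].
case: x xs => [v|p] //= ps; case: eqP => // <- [->].
rewrite mem_cat; apply/orP; right.
rewrite /pt; case: insubP => [q _ qE|].
  suff -> : q = p by [].
  by apply: val_inj; rewrite qE -surjective_pairing.
by rewrite /=; case/negP; exact: (valP p).
Qed.

Definition ext_vertex (e : gedge G) (j : nat) : seq_sub ext_points :=
  SeqSub (mem_breakpoint e j).

(* The edge (e, j) is the part of e between its breakpoints j and j + 1. *)
Definition extended_graph : metric_graph R :=
  @MetricGraph R (seq_sub ext_points)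
    {e : gedge G & 'I_(size (cuts e)).+1}
    (fun p => ext_vertex (tag p) (tagged p))
    (fun p => ext_vertex (tag p) (tagged p).+1)
    (fun p => breakpoint (tag p) (tagged p).+1 - breakpoint (tag p) (tagged p)).

Definition ext_point (x : gvert extended_graph) : point G := ssval x.

End ExtendedGraph.

Definition tanh (R : realType) (x : R) : R :=
  (expR x - expR (- x)) / (expR x + expR (- x)).

Definition incident (R : realType) (G : metric_graph R) (e : gedge G)
    (v : gvert G) : bool :=
  (gsrc e == v) || (gtgt e == v).

Definition precision_mx (R : realType) (G : metric_graph R) (kappa tau : R)
    (N : nat) (w : 'I_N -> gvert G) : 'M[R]_N :=
  \matrix_(i, j)
    if i == j then
      2 * kappa * tau ^+ 2 * \sum_(e | incident e (w i))
        ((2^-1 + expR (- 2 * kappa * glen e) / (1 - expR (- 2 * kappa * glen e)))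
           * (gtgt e != gsrc e)%:R
         + tanh (kappa * glen e / 2) * (gtgt e == gsrc e)%:R)
    else
      - (2 * kappa * tau ^+ 2) *
        \sum_(e | incident e (w i) && incident e (w j))
          expR (- kappa * glen e) / (1 - expR (- 2 * kappa * glen e)).

(* Main.v *)
(* Write L for the operator kappa^2 - Delta and call pieces the edges of the
   extended graph.  If g lies in the domain of L, then (u, L g) is Gaussian with
   variance tau^-2 |L^(1/2) g|^2 = tau^-2 (L g, g).  Given values c on the
   vertices of the extended graph, the solution g of L g = 0 on the pieces with
   these vertex values has fluxes tau^-2 Q c at the vertices, since Q / tau^2 is
   the Dirichlet-to-Neumann map; so L g is, as a distribution, the combination
   of Dirac masses at the vertices with weights a = tau^-2 Q c, and (L g, g) is
   the scalar product of a and c.  Correcting g near the vertices to have zero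
   derivatives there gives functions g_N in the domain with (u, L g_N)
   converging almost surely to the combination of the vertex values of u with
   weights a, while the variances of the differences tend to 0.  By Fatou's
   lemma the limit has variance tau^-2 (a, c), that is Q S Q = Q for the
   covariance matrix S of u at the vertices.  As Q is positive definite,
   S = Q^-1, and the claim follows by taking a Schur complement. *)

Require Import Defs.
From mathcomp Require Import ring lra measurable_realfun.
Set Implicit Arguments.
Unset Strict Implicit.
Unset Printing Implicit Defensive.
Local Open Scope classical_set_scope.
Local Open Scope ring_scope.

(** [whittle_pow] only asserts that, for each [psi], some eigenbasis represents L^(-1/2) psi; the
    basis may change with [psi], so linearity of L^(-1/2) is not immediate. Two devices avoid the
    difficulty: variances are expressed through (L g, g), which mentions no basis, and linearity is
    taken from the pathwise product (u, psi) instead of from L^(-1/2). Point evaluation is not a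
    functional on L_2, and a g with nonzero fluxes lies outside the domain of L, so vertex values
    are reached only as limits. The correctors are explicit in order to give rates: g_N - g is of
    order 1/N in the sup norm, while L g_N stays bounded in the L^1 norm. Pairing these two bounds
    yields both the limit of the energies and the Cauchy estimate in mean square. Eigenfunctions (by
    regularity) and test functions (by construction) are C^2 on closed pieces. Hence calculus with
    continuous functions suffices for the energy identities, and completeness of the eigenfunctions
    is applied only to piecewise continuous functions. *)

Local Notation mu := (@lebesgue_measure _).

(** * Calculus on an interval *)

Section Calculus.
Context {R : realType}.
Implicit Types (a b t : R) (f g F G : R -> R).

Definition itg a b f : R := \int[mu]_(t in `[a, b]) f t.

Lemma within_continuousD a b f g :
  {within `[a, b], continuous f} -> {within `[a, b], continuous g} ->
  {within `[a, b], continuous (fun t => f t + g t)}.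
Proof. by move=> cf cg z; apply: cvgD; [exact: cf|exact: cg]. Qed.

Lemma within_continuousM a b f g :
  {within `[a, b], continuous f} -> {within `[a, b], continuous g} ->
  {within `[a, b], continuous (fun t => f t * g t)}.
Proof. by move=> cf cg z; apply: cvgM; [exact: cf|exact: cg]. Qed.

Lemma within_continuousZ a b (c : R) f :
  {within `[a, b], continuous f} ->
  {within `[a, b], continuous (fun t => c * f t)}.
Proof. by move=> cf; apply: within_continuousM => // z; exact: cvg_cst. Qed.

Lemma within_continuous_cst a b (c : R) :
  {within `[a, b], continuous (fun=> c : R)}.
Proof. by move=> z; exact: cvg_cst. Qed.

Lemma within_continuous_norm a b f :
  {within `[a, b], continuous f} ->
  {within `[a, b], continuous (fun t => `|f t|)}.
Proof. by move=> cf z; apply: cvg_norm; exact: cf. Qed.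

Lemma within_continuous_sum (I : Type) (s : seq I) a b (f : I -> R -> R) :
  (forall i, {within `[a, b], continuous (f i)}) ->
  {within `[a, b], continuous (fun t => \sum_(i <- s) f i t)}.
Proof.
move=> cf; elim: s => [|i s IH].
  rewrite (_ : (fun t => _) = fun=> 0); first exact: within_continuous_cst.
  by apply/funext => t; rewrite big_nil.
rewrite (_ : (fun t => _) = fun t => f i t + \sum_(j <- s) f j t).
  exact: within_continuousD.
by apply/funext => t; rewrite big_cons.
Qed.

Lemma within_continuousS a b a' b' f : a <= a' -> b' <= b ->
  {within `[a, b], continuous f} -> {within `[a', b'], continuous f}.
Proof.
move=> aa bb; apply: continuous_subspaceW => x /=.
by rewrite !in_itv/= => /andP[? ?]; apply/andP; split; apply: le_trans; eauto.
Qed.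

Lemma within_continuous_integrable a b f :
  {within `[a, b], continuous f} -> mu.-integrable `[a, b] (EFin \o f).
Proof.
by move=> cf; apply: continuous_compact_integrable => //; exact: segment_compact.
Qed.

Lemma itgD a b f g :
  {within `[a, b], continuous f} -> {within `[a, b], continuous g} ->
  itg a b (fun t => f t + g t) = itg a b f + itg a b g.
Proof. by move=> cf cg; apply: RintegralD => //; exact: within_continuous_integrable. Qed.

Lemma itgZ a b c f : {within `[a, b], continuous f} ->
  itg a b (fun t => c * f t) = c * itg a b f.
Proof. by move=> cf; apply: RintegralZl => //; exact: within_continuous_integrable. Qed.

Lemma eq_itg a b f g : (forall t, a <= t <= b -> f t = g t) ->
  itg a b f = itg a b g.
Proof. by move=> fg; apply: eq_Rintegral => t; rewrite inE/= in_itv/=; exact: fg. Qed.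

Lemma itg0 a b : itg a b (fun=> 0) = 0.
Proof. by rewrite /itg Rintegral_cst// mul0r. Qed.

Lemma itg_ge0 a b f : (forall t, a <= t <= b -> 0 <= f t) -> 0 <= itg a b f.
Proof. by move=> f0; apply: Rintegral_ge0 => t /=; rewrite in_itv/=; exact: f0. Qed.

Lemma le_itg a b f g :
  {within `[a, b], continuous f} -> {within `[a, b], continuous g} ->
  (forall t, a <= t <= b -> f t <= g t) -> itg a b f <= itg a b g.
Proof.
move=> cf cg fg; apply: le_Rintegral => //; exact: within_continuous_integrable.
Qed.

Lemma le_norm_itg a b f : {within `[a, b], continuous f} ->
  `|itg a b f| <= itg a b (fun t => `|f t|).
Proof.
by move=> cf; apply: le_normr_Rintegral => //; exact: within_continuous_integrable.
Qed.

(** At the ends no derivative is asked for: there [f1] is fixed by continuity, and its end values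
    are the one-sided derivatives that enter Kirchhoff's conditions. *)
Definition C1_on a b f f1 : Prop :=
  [/\ {within `[a, b], continuous f}, {within `[a, b], continuous f1} &
      forall t, a < t < b -> is_derive t 1 f (f1 t)].

Lemma C1_onS a b a' b' f f1 : a <= a' -> b' <= b ->
  C1_on a b f f1 -> C1_on a' b' f f1.
Proof.
move=> aa bb [cf cf1 df]; split.
- exact: (within_continuousS aa bb).
- exact: (within_continuousS aa bb).
- move=> t /andP[ta tb]; apply: df.
  by rewrite (le_lt_trans aa ta) (lt_le_trans tb bb).
Qed.

Lemma C1_onD a b f f1 g g1 : C1_on a b f f1 -> C1_on a b g g1 ->
  C1_on a b (fun t => f t + g t) (fun t => f1 t + g1 t).
Proof.
move=> [cf cf1 df] [cg cg1 dg]; split; try exact: within_continuousD.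
by move=> t tab; have := df t tab; have := dg t tab => ? ?; exact: is_deriveD.
Qed.

Lemma C1_onM a b f f1 g g1 : C1_on a b f f1 -> C1_on a b g g1 ->
  C1_on a b (fun t => f t * g t) (fun t => f1 t * g t + f t * g1 t).
Proof.
move=> [cf cf1 df] [cg cg1 dg]; split; first exact: within_continuousM.
  by apply: within_continuousD; exact: within_continuousM.
move=> t tab; have := df t tab; have := dg t tab => ? ?.
by apply: is_derive_eq; rewrite /= /GRing.scale/= addrC [g t * _]mulrC.
Qed.

Lemma C1_on_cst a b c : C1_on a b (fun=> c) (fun=> 0).
Proof.
split; try exact: within_continuous_cst.
by move=> t _; exact: is_derive_cst.
Qed.

Lemma C1_onZ a b c f f1 : C1_on a b f f1 ->
  C1_on a b (fun t => c * f t) (fun t => c * f1 t).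
Proof.
move=> hf; have := C1_onM (C1_on_cst a b c) hf.
by under [X in C1_on _ _ _ X -> _]funext do rewrite mul0r add0r.
Qed.

Lemma C1_on_derive a b f f1 : continuous f1 ->
  (forall t, is_derive t 1 f (f1 t)) -> C1_on a b f f1.
Proof.
move=> cf1 df; split => //; apply: continuous_subspaceT => //.
move=> t; apply/differentiable_continuous/derivable1_diffP.
by have := df t => -[].
Qed.

Lemma itg_C1 a b F f : a < b -> C1_on a b F f -> itg a b f = F b - F a.
Proof.
move=> ab [cF cf dF].
have [/= cF0 cFa cFb] := (continuous_within_itvP _ ab).1 cF.
rewrite /itg /Rintegral (@continuous_FTC2 _ _ F)//=.
  split => // t tab; rewrite in_itv/= in tab.
  by have [] := dF t tab.
move=> t tab; rewrite in_itv/= in tab.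
by rewrite derive1E; have [_ ->] := dF t tab.
Qed.

Lemma C1_on_primitive (l : R) F f : 0 < l -> {within `[0, l], continuous f} ->
  (forall t, 0 <= t <= l -> F t = F 0 + itg 0 t f) -> C1_on 0 l F f.
Proof.
move=> l0 cf FE; have intf := within_continuous_integrable cf.
have cG : {within `[0, l], continuous (fun t => itg 0 t f)}.
  exact: (parameterized_integral_continuous (ltW l0) intf).
split => //.
  apply: (@subspace_eq_continuous _ _ _ (fun t => F 0 + itg 0 t f)).
    by move=> t; rewrite inE/= in_itv/= => tl; rewrite /= -FE.
  by apply: within_continuousD => //; exact: within_continuous_cst.
move=> t /andP[t0 tl].
have ft : {for t, continuous f}.
  have [/= cF0 cFa cFb] := (continuous_within_itvP _ l0).1 cf.
  by apply: cF0; rewrite in_itv/= t0.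
have := continuous_FTC1_closed tl intf t0 ft.
move=> [dG Gt].
have : is_derive t 1 (fun t => F 0 + itg 0 t f) (f t).
  have ? : is_derive t 1 (fun t => itg 0 t f) (f t).
    by apply: DeriveDef; [exact: dG|rewrite -derive1E; exact: Gt].
  by rewrite -[f t]add0r; apply: is_deriveD.
apply: near_eq_is_derive.
have nt : \forall x \near t, x \in `]0, l[.
  by apply: near_in_itvoo; rewrite in_itv/= t0.
near=> x; rewrite -FE//.
have : x \in `]0, l[ by near: x.
by rewrite in_itv/= => /andP[? ?]; rewrite !ltW.
Unshelve. all: by end_near. Qed.

End Calculus.

(** * Functions on the pieces of a graph *)

Section CalculusMore.
Context {R : realType}.
Implicit Types (a b t : R) (f g F G : R -> R).

Lemma itg_split a b t f : a <= t -> t <= b ->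
  mu.-integrable `[a, b] (EFin \o f) ->
  itg a b f = itg a t f + itg t b f.
Proof.
move=> at_ tb intf; apply/eqP; rewrite addrC -subr_eq; apply/eqP.
rewrite /itg Rintegral_itvB// ?bnd_simp//.
rewrite Rintegral_itv_obnd_cbnd//.
apply: integrableS intf => // x /=; rewrite !in_itv/= => /andP[tx ->].
by rewrite (le_trans at_ (ltW tx)).
Qed.

Lemma itg_sum (I : Type) (s : seq I) a b (f : I -> R -> R) :
  (forall i, {within `[a, b], continuous (f i)}) ->
  itg a b (fun t => \sum_(i <- s) f i t) = \sum_(i <- s) itg a b (f i).
Proof.
move=> cf; elim: s => [|i s IH].
  by rewrite big_nil -[RHS](itg0 a b); apply: eq_itg => t _; rewrite big_nil.
rewrite big_cons -IH -itgD//; last exact: within_continuous_sum.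
by apply: eq_itg => t _; rewrite big_cons.
Qed.

(** Sobolev's inequality. Integrating the derivative of (s - c) f(s)^2, with c = a on [a, t] and c =
    b on [t, b], removes the boundary terms at a and b and bounds both (t - a) f(t)^2 and (b - t)
    f(t)^2 by (1 + (b - a)) times the squared H^1 norm. The two weights add up to b - a. *)
Lemma sqr_le_itg_C1 a b f f1 t : a < b -> C1_on a b f f1 -> a <= t <= b ->
  f t ^+ 2 <= 2 * (1 + (b - a)) / (b - a) *
    (itg a b (fun s => f s * f s) + itg a b (fun s => f1 s * f1 s)).
Proof.
move=> ab hf /andP[at_ tb].
have [cf cf1 _] := hf.
have cff := within_continuousM cf cf; have cff1 := within_continuousM cf1 cf1.
set A := itg a b _; set B := itg a b _.
have pos s : 0 <= f s * f s + f1 s * f1 s by rewrite -!expr2 addr_ge0 ?sqr_ge0.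
have cS : {within `[a, b], continuous (fun s => f s * f s + f1 s * f1 s)}.
  exact: within_continuousD.
have id1 : C1_on a b (fun s : R => s) (fun=> 1).
  by apply: C1_on_derive => s; exact: cvg_cst.
have key (c t1 t2 : R) : a <= t1 -> t1 <= t2 -> t2 <= b ->
    (forall s, t1 <= s <= t2 -> `|s - c| <= b - a) ->
    (t2 - c) * f t2 ^+ 2 - (t1 - c) * f t1 ^+ 2 <= (1 + (b - a)) * (A + B).
  move=> at1; rewrite le_eqVlt => /predU1P[<-|t12] t2b ec.
    rewrite subrr; apply: mulr_ge0; first by lra.
    by apply: addr_ge0; apply: itg_ge0 => s _; rewrite -expr2 sqr_ge0.
  have hg : C1_on t1 t2 (fun s => (s + - c) * (f s * f s))
      (fun s => (1 + 0) * (f s * f s) +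
         (s + - c) * (f1 s * f s + f s * f1 s)).
    apply: (@C1_onS _ a b) => //; apply: C1_onM; last exact: C1_onM.
    by apply: C1_onD => //; exact: C1_on_cst.
  have := itg_C1 t12 hg; rewrite !expr2 => <-.
  have [_ cg _] := hg.
  have -> : (1 + (b - a)) * (A + B) =
      itg a b (fun s => (1 + (b - a)) * (f s * f s + f1 s * f1 s)).
    by rewrite itgZ// itgD.
  have cZ : {within `[a, b], continuous
      (fun s => (1 + (b - a)) * (f s * f s + f1 s * f1 s))}.
    exact: within_continuousZ.
  have posZ s : 0 <= (1 + (b - a)) * (f s * f s + f1 s * f1 s).
    by apply: mulr_ge0 => //; lra.
  rewrite (@itg_split a b t1) ?(le_trans (ltW t12))//; last first.
    exact: within_continuous_integrable.
  rewrite (@itg_split t1 b t2) ?(ltW t12)//; last first.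
    apply: within_continuous_integrable.
    exact: (within_continuousS at1 (lexx b)).
  rewrite -[leLHS]add0r lerD//; first exact: itg_ge0.
  rewrite -[leLHS]addr0 lerD//; last exact: itg_ge0.
  apply: le_itg => //; first exact: (within_continuousS at1 t2b).
  move=> s st; have := ec s st; have l0 : 0 <= b - a by rewrite subr_ge0 ltW.
  move: (f s) (f1 s) (s + - c) => x y w wl.
  have : w * (2 * (x * y)) <= (b - a) * (x * x + y * y).
    apply: le_trans (ler_norm _) _; rewrite normrM.
    apply: ler_pM => //; rewrite !normrM normr_nat.
    have := sqr_ge0 (`|x| - `|y|); rewrite sqrrB !real_normK ?num_real//.
    by rewrite -!expr2; lra.
  have : 0 <= y * y by rewrite -expr2 sqr_ge0.
  lra.
have l0 : 0 < b - a by rewrite subr_gt0.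
have h1 := key a a t (lexx _) at_ tb.
have h2 := key b t b at_ tb (lexx _).
rewrite -subr_ge0 -(pmulr_rge0 _ l0).
have -> : (b - a) * (2 * (1 + (b - a)) / (b - a) * (A + B) - f t ^+ 2) =
    2 * (1 + (b - a)) * (A + B) - (b - a) * f t ^+ 2 by field; rewrite gt_eqF.
have {}h1 : (t - a) * f t ^+ 2 <= (1 + (b - a)) * (A + B).
  apply: le_trans (h1 _); first by rewrite subrr mul0r subr0.
  by move=> s /andP[? st]; rewrite ger0_norm ?subr_ge0//; lra.
have {}h2 : (b - t) * f t ^+ 2 <= (1 + (b - a)) * (A + B).
  have e2 s : t <= s <= b -> `|s - b| <= b - a.
    by move=> /andP[ts sb]; rewrite ler0_norm ?subr_le0//; lra.
  have := h2 e2; lra.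
lra.
Qed.

Lemma cvg_dist_le (u e : nat -> R) (l : R) :
  (forall n, `|u n - l| <= e n) -> e n @[n --> \oo] --> 0 ->
  u n @[n --> \oo] --> l.
Proof.
move=> ule e0; apply/subr_cvg0/norm_cvg0P.
apply: (@squeeze_cvgr _ _ _ _ (fun=> 0) e); last exact: e0.
  by apply: nearW => n; rewrite normr_ge0 ule.
exact: cvg_cst.
Qed.

End CalculusMore.

(** * The Kirchhoff Laplacian and its quadratic form on pieces *)

Section Pieces.
Context {R : realType} {I V : finType} (a b : I -> R) (src tgt : I -> V).
Hypothesis ab : forall i, a i < b i.
Implicit Types F G H : I -> R -> R.

(** A piece keeps the coordinate of the edge containing it, hence the general intervals [a i, b i]:
    restricting a function from an edge to a piece then involves no change of variable. *)
Definition pcont F : Prop := forall i, {within `[a i, b i], continuous F i}.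

Definition ip F G : R := \sum_i itg (a i) (b i) (fun t => F i t * G i t).

Lemma pcontD F G : pcont F -> pcont G -> pcont (fun i t => F i t + G i t).
Proof. by move=> cF cG i; exact: within_continuousD. Qed.

Lemma pcontZ c F : pcont F -> pcont (fun i t => c * F i t).
Proof. by move=> cF i; exact: within_continuousZ. Qed.

Lemma eq_ip F F' G G' :
  (forall i t, a i <= t <= b i -> F i t = F' i t) ->
  (forall i t, a i <= t <= b i -> G i t = G' i t) -> ip F G = ip F' G'.
Proof.
move=> FF GG; apply: eq_bigr => i _; apply: eq_itg => t tab.
by rewrite FF// GG.
Qed.

Lemma ipC F G : ip F G = ip G F.
Proof. by apply: eq_bigr => i _; apply: eq_itg => t _; rewrite mulrC. Qed.

Lemma ipDl F G H : pcont F -> pcont G -> pcont H ->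
  ip (fun i t => F i t + G i t) H = ip F H + ip G H.
Proof.
move=> cF cG cH; rewrite -big_split; apply: eq_bigr => i _ /=.
rewrite -itgD; [|exact: within_continuousM..].
by apply: eq_itg => t _; rewrite mulrDl.
Qed.

Lemma ipZl c F H : pcont F -> pcont H ->
  ip (fun i t => c * F i t) H = c * ip F H.
Proof.
move=> cF cH; rewrite /ip mulr_sumr; apply: eq_bigr => i _ /=.
rewrite -itgZ; last exact: within_continuousM.
by apply: eq_itg => t _; rewrite mulrA.
Qed.

Lemma ipDr F G H : pcont F -> pcont G -> pcont H ->
  ip H (fun i t => F i t + G i t) = ip H F + ip H G.
Proof. by move=> *; rewrite ipC ipDl// !(ipC H). Qed.

Lemma ipZr c F H : pcont F -> pcont H ->
  ip H (fun i t => c * F i t) = c * ip H F.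
Proof. by move=> *; rewrite ipC ipZl// (ipC H). Qed.

Lemma ip_ge0 F : 0 <= ip F F.
Proof.
by apply: sumr_ge0 => i _; apply: itg_ge0 => t _; rewrite -expr2 sqr_ge0.
Qed.

Definition L1norm F := \sum_i itg (a i) (b i) (fun t => `|F i t|).

Lemma L1norm_ge0 F : 0 <= L1norm F.
Proof. by apply: sumr_ge0 => i _; apply: itg_ge0. Qed.

Lemma norm_ip_le F G (e : R) : pcont F -> pcont G ->
  (forall i t, a i <= t <= b i -> `|F i t| <= e) ->
  `|ip F G| <= e * L1norm G.
Proof.
move=> cF cG Fe; apply: le_trans (ler_norm_sum _ _ _) _.
rewrite mulr_sumr; apply: ler_sum => i _.
have cFG := within_continuousM (cF i) (cG i).
apply: le_trans (le_norm_itg cFG) _.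
have cnG := within_continuous_norm (cG i).
rewrite -itgZ//; apply: le_itg.
- exact: within_continuous_norm.
- exact: within_continuousZ.
- by move=> t tab; rewrite normrM ler_wpM2r// Fe.
Qed.

Lemma ip_unif_cvg (F_ : nat -> I -> R -> R) F G (e : nat -> R) :
  (forall n, pcont (F_ n)) -> pcont F -> pcont G ->
  (forall n i t, a i <= t <= b i -> `|F_ n i t - F i t| <= e n) ->
  e n @[n --> \oo] --> 0 ->
  ip (F_ n) G @[n --> \oo] --> ip F G.
Proof.
move=> cF_ cF cG Fe e0.
have cN : pcont (fun i t => - 1 * F i t) by exact: pcontZ.
apply: (@cvg_dist_le _ _ (fun n => e n * L1norm G)); last first.
  by rewrite -[X in _ --> X](mul0r (L1norm G)); apply: cvgMr_tmp.
move=> n; have -> : ip (F_ n) G - ip F G =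
    ip (fun i t => F_ n i t + -1 * F i t) G by rewrite ipDl// ipZl// mulN1r.
apply: norm_ip_le => //; first exact: pcontD.
by move=> i t tab; rewrite mulN1r Fe.
Qed.

(* The domain of the Kirchhoff Laplacian for functions given piece by piece,
   together with their first two derivatives [F1] and [F2]. *)
Definition dom F F1 F2 : Prop :=
  [/\ forall i, C1_on (a i) (b i) (F i) (F1 i),
      forall i, C1_on (a i) (b i) (F1 i) (F2 i),
      exists val : V -> R, forall i,
        F i (a i) = val (src i) /\ F i (b i) = val (tgt i)
    & forall v, \sum_(i | src i == v) F1 i (a i)
              - \sum_(i | tgt i == v) F1 i (b i) = 0].

Lemma dom_pcont F F1 F2 : dom F F1 F2 -> [/\ pcont F, pcont F1 & pcont F2].
Proof. by case=> h1 h2 _ _; split=> i; have [? ? _] := h1 i; have [? ? _] := h2 i. Qed.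

Lemma dom0 : dom (fun _ _ => 0) (fun _ _ => 0) (fun _ _ => 0).
Proof.
split; try by move=> i; exact: C1_on_cst.
  by exists (fun=> 0).
by move=> v; rewrite !big1 ?subrr.
Qed.

Lemma dom_lin c F F1 F2 G G1 G2 : dom F F1 F2 -> dom G G1 G2 ->
  dom (fun i t => F i t + c * G i t) (fun i t => F1 i t + c * G1 i t)
      (fun i t => F2 i t + c * G2 i t).
Proof.
move=> [F01 F12 [vF hF] kF] [G01 G12 [vG hG] kG]; split.
- by move=> i; apply: C1_onD => //; exact: C1_onZ.
- by move=> i; apply: C1_onD => //; exact: C1_onZ.
- exists (fun v => vF v + c * vG v) => i.
  by have [-> ->] := hF i; have [-> ->] := hG i.
- move=> v; rewrite !big_split/= -!mulr_sumr.
  have := kF v; have := kG v => /eqP; rewrite subr_eq0 => /eqP ->.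
  by move=> /eqP; rewrite subr_eq0 => /eqP ->; rewrite subrr.
Qed.

Lemma dom_sum (c : nat -> R) (F F1 F2 : nat -> I -> R -> R) n :
  (forall k, dom (F k) (F1 k) (F2 k)) ->
  dom (fun i t => \sum_(k < n) c k * F k i t)
      (fun i t => \sum_(k < n) c k * F1 k i t)
      (fun i t => \sum_(k < n) c k * F2 k i t).
Proof.
move=> h; elim: n => [|n IH].
  have E (H : nat -> I -> R -> R) :
      (fun i t => \sum_(k < 0) c k * H k i t) = (fun _ _ => 0 : R).
    by apply/funext => i; apply/funext => t; rewrite big_ord0.
  by rewrite !E; exact: dom0.
have E (H : nat -> I -> R -> R) :
    (fun i t => \sum_(k < n.+1) c k * H k i t) =
    (fun i t => \sum_(k < n) c k * H k i t + c n * H n i t).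
  by apply/funext => i; apply/funext => t; rewrite big_ord_recr.
by rewrite !E; exact: dom_lin.
Qed.

Lemma ip_suml (c : nat -> R) (F : nat -> I -> R -> R) H n :
  (forall k, pcont (F k)) -> pcont H ->
  ip (fun i t => \sum_(k < n) c k * F k i t) H = \sum_(k < n) c k * ip (F k) H.
Proof.
move=> cF cH; under [RHS]eq_bigr => k _ do rewrite mulr_sumr.
rewrite exchange_big; apply: eq_bigr => i _ /=.
transitivity (itg (a i) (b i) (fun t => \sum_(k < n) c k * (F k i t * H i t))).
  apply: eq_itg => t _; rewrite mulr_suml; apply: eq_bigr => k _.
  by rewrite mulrA.
have cFH k : {within `[a i, b i], continuous (fun t => F k i t * H i t)}.
  exact: within_continuousM (cF k i) (cH i).
rewrite (@itg_sum _ _ _ _ _ (fun (k : 'I_n) t => c k * (F k i t * H i t))).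
  by apply: eq_bigr => k _; rewrite itgZ.
by move=> k; apply: within_continuousZ.
Qed.

(** After integration by parts the boundary terms are grouped by vertex: at a vertex [G] has a
    single value by continuity, and it multiplies the sum of the derivatives of [F], which
    Kirchhoff's condition makes 0. *)
Lemma green F F1 F2 G G1 G2 : dom F F1 F2 -> dom G G1 G2 ->
  ip F2 G = - ip F1 G1.
Proof.
move=> [_ F12 _ kF] [G01 _ [val hG] _].
apply/eqP; rewrite -addr_eq0 /ip -big_split/=; apply/eqP.
transitivity (\sum_i (F1 i (b i) * val (tgt i) - F1 i (a i) * val (src i))).
  apply: eq_bigr => i _; have hFG := C1_onM (F12 i) (G01 i).
  have [cF1 cF2 _] := F12 i; have [cG cG1 _] := G01 i.
  rewrite -itgD; [|exact: within_continuousM..].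
  by rewrite (itg_C1 (ab i) hFG); have [-> ->] := hG i.
rewrite big_split/= (partition_big tgt xpredT)//=.
rewrite [X in _ + X](partition_big src xpredT)//= -big_split/=.
apply: big1 => v _.
rewrite (eq_bigr (fun i => F1 i (b i) * val v)) => [|i /eqP->//].
rewrite [X in _ + X](eq_bigr (fun i => - F1 i (a i) * val v)); last first.
  by move=> i /eqP->; rewrite mulNr.
rewrite -!mulr_suml sumrN -mulrDl.
by have /eqP := kF v; rewrite subr_eq0 => /eqP ->; rewrite subrr mul0r.
Qed.

Section Energy.
Context (kappa : R).
Hypothesis kappa0 : 0 < kappa.

Definition Lop F F2 : I -> R -> R := fun i t => kappa ^+ 2 * F i t - F2 i t.

Lemma pcont_Lop F F1 F2 : dom F F1 F2 -> pcont (Lop F F2).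
Proof.
move=> /dom_pcont[cF _ cF2] i; apply: within_continuousD.
  exact: within_continuousZ.
rewrite (_ : (fun t => - F2 i t) = fun t => - 1 * F2 i t).
  exact: within_continuousZ.
by apply/funext => t; rewrite mulN1r.
Qed.

Lemma Lop_energy F F1 F2 G G1 G2 : dom F F1 F2 -> dom G G1 G2 ->
  ip (Lop F F2) G = kappa ^+ 2 * ip F G + ip F1 G1.
Proof.
move=> dF dG; have [cF _ cF2] := dom_pcont dF; have [cG _ _] := dom_pcont dG.
rewrite -[ip F1 G1]opprK -(green dF dG).
transitivity (ip (fun i t => kappa ^+ 2 * F i t + -1 * F2 i t) G).
  by apply: eq_ip => // i t _; rewrite mulN1r.
by rewrite ipDl ?ipZl ?mulN1r//; exact: pcontZ.
Qed.

Lemma Lop_sym F F1 F2 G G1 G2 : dom F F1 F2 -> dom G G1 G2 ->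
  ip (Lop F F2) G = ip F (Lop G G2).
Proof.
by move=> dF dG; rewrite [RHS]ipC (Lop_energy dF dG) (Lop_energy dG dF) !(ipC G) (ipC G1).
Qed.

Lemma Lop_ge0 F F1 F2 : dom F F1 F2 -> 0 <= ip (Lop F F2) F.
Proof.
move=> dF; rewrite (Lop_energy dF dF) addr_ge0//; last exact: ip_ge0.
by rewrite mulr_ge0 ?sqr_ge0// ip_ge0.
Qed.

Lemma sobolev_sup : exists2 C : R, 0 < C & forall F F1 F2, dom F F1 F2 ->
  forall i t, a i <= t <= b i -> F i t ^+ 2 <= C * ip (Lop F F2) F.
Proof.
pose c i := 2 * (1 + (b i - a i)) / (b i - a i).
have c0 i : 0 <= c i.
  have : 0 < b i - a i by rewrite subr_gt0.
  by move=> h; rewrite /c divr_ge0 ?ltW// mulr_gt0// addr_gt0.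
have k2 : 0 < kappa ^- 2 by rewrite invr_gt0 exprn_gt0.
(* The factor 1 + kappa^-2 passes from the energy to the squared H^1 norm. The summand 1 keeps the
   constant positive even when there are no pieces. *)
exists ((1 + \sum_i c i) * (1 + kappa ^- 2)).
  apply: mulr_gt0; last by rewrite addr_gt0.
  by apply: ltr_wpDr => //; exact: sumr_ge0.
move=> F F1 F2 dF i t tab; rewrite (Lop_energy dF dF).
have [h _ _ _] := dF.
apply: le_trans (sqr_le_itg_C1 (ab i) (h i) tab) _; rewrite -/(c i).
set A := itg _ _ _; set B := itg _ _ _.
have AA : A <= ip F F.
  rewrite /ip (bigD1 i)//= lerDl; apply: sumr_ge0 => j _.
  by apply: itg_ge0 => s _; rewrite -expr2 sqr_ge0.
have BB : B <= ip F1 F1.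
  rewrite /ip (bigD1 i)//= lerDl; apply: sumr_ge0 => j _.
  by apply: itg_ge0 => s _; rewrite -expr2 sqr_ge0.
have A0 : 0 <= A by apply: itg_ge0 => s _; rewrite -expr2 sqr_ge0.
have B0 : 0 <= B by apply: itg_ge0 => s _; rewrite -expr2 sqr_ge0.
rewrite -mulrA; apply: ler_pM => //; first by rewrite addr_ge0.
  rewrite (bigD1 i)//= addrCA lerDl addr_ge0//.
  by apply: sumr_ge0 => j _; exact: c0.
rewrite mulrDl mul1r mulrDr mulrA mulVf ?expf_neq0 ?gt_eqF// mul1r.
have : 0 <= kappa ^+ 2 * ip F F by rewrite mulr_ge0 ?sqr_ge0//; exact: ip_ge0.
have : 0 <= kappa ^- 2 * ip F1 F1 by rewrite mulr_ge0 ?ip_ge0 ?ltW//.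
lra.
Qed.

End Energy.
End Pieces.

(** * Eigenfunction expansions *)

Section UniformCauchy.
Context {R : realType}.

Lemma within_continuous_unif_cvg (a b : R) (f_ : nat -> R -> R) (f : R -> R)
    (e : nat -> R) :
  (forall n, {within `[a, b], continuous (f_ n)}) ->
  (forall n t, a <= t <= b -> `|f_ n t - f t| <= e n) ->
  e n @[n --> \oo] --> 0 ->
  {within `[a, b], continuous f}.
Proof.
move=> cf fe e0; apply/subspace_continuousP => x xab.
apply/cvgrPdist_le => /= eps eps0.
have eps3 : 0 < eps / 3 by rewrite divr_gt0.
have [n _ /(_ n (leqnn n)) en] : \forall n \near \oo, `|e n| <= eps / 3.
  by move/cvgr0Pnorm_le : e0; exact.
have {en} en : e n <= eps / 3 by exact: le_trans (ler_norm _) en.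
have /subspace_continuousP/(_ x xab)/cvgrPdist_le/(_ _ eps3) := cf n.
rewrite !near_withinE/=; apply: filterS => t ht tab.
have := ht tab; have := fe n x; have := fe n t.
move: xab tab; rewrite /= !in_itv/= => -> -> /(_ isT) h1 /(_ isT) h2 h3.
have -> : f x - f t = - (f_ n x - f x) + (f_ n x - f_ n t) + (f_ n t - f t) by ring.
apply: le_trans (ler_normD _ _) _; apply: le_trans (lerD (ler_normD _ _) (lexx _)) _.
by rewrite normrN; lra.
Qed.

End UniformCauchy.

Section Spectral.
Context {R : realType} {I V : finType} (a b : I -> R) (src tgt : I -> V).
Hypothesis ab : forall i, a i < b i.
Context (kappa : R).
Hypothesis kappa0 : 0 < kappa.
Context (lam : nat -> R) (phi phi1 phi2 : nat -> I -> R -> R).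
Hypothesis dphi : forall k, dom a b src tgt (phi k) (phi1 k) (phi2 k).
Hypothesis eig : forall k i t, a i <= t <= b i ->
  phi2 k i t = (kappa ^+ 2 - lam k) * phi k i t.
Hypothesis orth : forall j k, ip a b (phi j) (phi k) = (j == k)%:R.
Hypothesis complete : forall r, pcont a b r ->
  (forall k, ip a b r (phi k) = 0) ->
  forall h, pcont a b h -> ip a b r h = 0.

Local Notation ip := (ip a b).
Local Notation L := (Lop kappa).
Local Notation dom := (dom a b src tgt).
Local Notation pcont := (pcont a b).

Let cphi k : pcont (phi k). Proof. by have [] := dom_pcont (dphi k). Qed.

Lemma ip_Lop_eigen F F1 F2 k : dom F F1 F2 ->
  ip (L F F2) (phi k) = lam k * ip F (phi k).
Proof.
move=> dF; have [cF _ _] := dom_pcont dF.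
rewrite (Lop_sym ab kappa dF (dphi k)) -ipZr//.
by apply: eq_ip => // i t tab; rewrite /Lop eig//; ring.
Qed.

Lemma eigenvalue_gt0 k : 0 < lam k.
Proof.
have := Lop_energy ab kappa (dphi k) (dphi k).
rewrite (ip_Lop_eigen _ (dphi k)) orth eqxx !mulr1 => ->.
by rewrite ltr_wpDr ?ip_ge0// exprn_gt0.
Qed.

Let S (c : nat -> R) n := fun i t => \sum_(k < n) c k * phi k i t.
Let S1 (c : nat -> R) n := fun i t => \sum_(k < n) c k * phi1 k i t.
Let S2 (c : nat -> R) n := fun i t => \sum_(k < n) c k * phi2 k i t.

Let dS c n : dom (S c n) (S1 c n) (S2 c n). Proof. exact: dom_sum. Qed.

Let ipS c n j : ip (S c n) (phi j) = if (j < n)%N then c j else 0.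
Proof.
rewrite ip_suml//; case: ltnP => jn.
  rewrite (bigD1 (Ordinal jn))//= orth eqxx mulr1 big1 ?addr0// => k kj.
  rewrite orth (_ : _ == _ = false) ?mulr0//; apply: contraNF kj => /eqP kj.
  exact/eqP/val_inj.
by rewrite big1// => k _; rewrite orth ltn_eqF ?mulr0// (leq_trans (ltn_ord k)).
Qed.

Let energyS c n : ip (L (S c n) (S2 c n)) (S c n) = \sum_(k < n) lam k * c k ^+ 2.
Proof.
have cLS := pcont_Lop (kappa := kappa) (dS c n).
rewrite [LHS]ipC (ip_suml c n cphi cLS).
apply: eq_bigr => k _.
rewrite ipC (ip_Lop_eigen _ (dS c n)) ipS ltn_ord; ring.
Qed.

(* By the Sobolev inequality the partial sums of the eigenfunction expansion of
   [g] converge uniformly; the remainder converges to a continuous function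
   orthogonal to every eigenfunction, hence to 0, so no Riesz-Fischer theorem is
   needed. *)
Lemma energy_parseval g g1 g2 : dom g g1 g2 ->
  \sum_(k < n) lam k * ip g (phi k) ^+ 2 @[n --> \oo] --> ip (L g g2) g.
Proof.
move=> dg; pose be k := ip g (phi k).
have [cg _ _] := dom_pcont dg; have cLg := pcont_Lop (kappa := kappa) dg.
pose s n := \sum_(k < n) lam k * be k ^+ 2.
pose r n := fun i t => g i t + -1 * S be n i t.
pose r2 n := fun i t => g2 i t + -1 * S2 be n i t.
have dr n : dom (r n) _ (r2 n) := dom_lin (-1) dg (dS be n).
have cS n : pcont (S be n) by have [] := dom_pcont (dS be n).
have cr n : pcont (r n) by have [] := dom_pcont (dr n).
have rphi n k : (k < n)%N -> ip (r n) (phi k) = 0.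
  by move=> kn; rewrite ipDl ?ipZl//; [rewrite ipS kn mulN1r subrr|exact: pcontZ].
have LgS n : ip (L g g2) (S be n) = s n.
  rewrite ipC (ip_suml be n cphi cLg); apply: eq_bigr => k _.
  by rewrite ipC (ip_Lop_eigen _ dg) -/(be k); ring.
have Lgr n : ip (L g g2) (r n) = ip (L g g2) g - s n.
  by rewrite ipDr ?ipZr//; [rewrite LgS; ring|exact: pcontZ].
(* L applied to the partial sum stays in the span of the first [n] eigenfunctions, to which [r n] is
   orthogonal. So the energy of the remainder is exactly what [s n] lacks, and its positivity is
   Bessel's inequality. *)
have Er n : ip (L (r n) (r2 n)) (r n) = ip (L g g2) g - s n.
  rewrite -Lgr.
  have -> : ip (L (r n) (r2 n)) (r n) =
      ip (fun i t => L g g2 i t + -1 * L (S be n) (S2 be n) i t) (r n).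
    by apply: eq_ip => // i t _; rewrite /Lop /r /r2; ring.
  have cLS := pcont_Lop (kappa := kappa) (dS be n).
  rewrite ipDl ?ipZl//; last exact: pcontZ.
  rewrite (_ : ip (L (S be n) _) _ = 0) ?mulr0 ?addr0//.
  rewrite (Lop_sym ab kappa (dS be n) (dr n)).
  rewrite (ip_suml be n cphi (pcont_Lop (kappa := kappa) (dr n))).
  rewrite big1// => k _; rewrite ipC (ip_Lop_eigen _ (dr n)).
  by rewrite rphi ?mulr0//; exact: ltn_ord.
have s_le n : s n <= ip (L g g2) g.
  by rewrite -subr_ge0 -Er (Lop_ge0 ab _ (dr n)).
have s_nd : nondecreasing_seq s.
  apply/nondecreasing_seqP => n; rewrite /s big_ord_recr/= lerDl.
  by rewrite mulr_ge0 ?sqr_ge0// ltW// eigenvalue_gt0.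
have s_cvg : cvgn s.
  apply: nondecreasing_is_cvgn => //.
  by exists (ip (L g g2) g) => _ [n _ <-].
set sl := limn s.
have s_sl n : s n <= sl by exact: nondecreasing_cvgn_le.
have [C C0 hC] := sobolev_sup src tgt ab kappa0.
have cauchy n m i t : (n <= m)%N -> a i <= t <= b i ->
    (S be m i t - S be n i t) ^+ 2 <= C * (s m - s n).
  (* A difference of partial sums is again a partial sum, with the first [n] coefficients set to 0,
     so [sobolev_sup] and [energyS] apply to it. *)
  move=> nm tab; pose c k := if (k < n)%N then 0 else be k.
  have split_sum (x : nat -> R) : \sum_(k < m) x k =
      \sum_(k < n) x k + \sum_(k < m) (if (k < n)%N then 0 else x k).
    rewrite -2!(big_mkord xpredT x) -(big_mkord xpredT
      (fun k => if (k < n)%N then 0 else x k)).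
    rewrite (big_cat_nat (leq0n n) nm)/=; congr (_ + _).
    rewrite [RHS](big_cat_nat (leq0n n) nm)//= [X in _ = X + _]big1_seq ?add0r.
      by apply: eq_big_nat => k /andP[nk _]; rewrite ltnNge nk.
    by move=> k; rewrite mem_index_iota => /andP[_ /andP[_ ->]].
  have -> : S be m i t - S be n i t = S c m i t.
    rewrite /S (split_sum (fun k => be k * phi k i t)) addrAC subrr add0r.
    by apply: eq_bigr => k _; rewrite /c; case: ifP => //; rewrite mul0r.
  have -> : s m - s n = \sum_(k < m) lam k * c k ^+ 2.
    rewrite /s (split_sum (fun k => lam k * be k ^+ 2)) addrAC subrr add0r.
    by apply: eq_bigr => k _; rewrite /c; case: ifP => //; rewrite expr0n mulr0.
  by rewrite -energyS; exact: (hC _ _ _ (dS c m)).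
pose T i t := limn (fun n => S be n i t).
pose e n := Num.sqrt (C * (sl - s n)).
have e0 : e n @[n --> \oo] --> 0.
  rewrite -[X in _ --> X]sqrtr0; apply: continuous_cvg; first exact: sqrt_continuous.
  rewrite -[X in _ --> X](mulr0 C) -(subrr sl).
  by apply: cvgMl_tmp; apply: cvgB => //; exact: cvg_cst.
have caue n m i t : (n <= m)%N -> a i <= t <= b i ->
    `|S be m i t - S be n i t| <= e n.
  move=> nm tab; rewrite -sqrtr_sqr ler_sqrt.
    apply: le_trans (cauchy _ _ _ _ nm tab) _.
    by rewrite ler_wpM2l ?(ltW C0)// lerB.
  by rewrite mulr_ge0 ?(ltW C0)// subr_ge0.
have cvgT i t : a i <= t <= b i -> S be n i t @[n --> \oo] --> T i t.
  move=> tab; apply/cauchy_cvgP/cauchy_exP => eps eps0.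
  have [n _ /(_ n (leqnn n)) en] : \forall n \near \oo, `|e n| < eps.
    by move/cvgr0Pnorm_lt : e0; exact.
  exists (S be n i t); exists n => // m /= nm.
  rewrite /ball/= distrC; apply: le_lt_trans (caue _ _ _ _ nm tab) _.
  exact: le_lt_trans (ler_norm _) en.
have TS n i t : a i <= t <= b i -> `|S be n i t - T i t| <= e n.
  move=> tab; rewrite distrC.
  have : `|S be m i t - S be n i t| @[m --> \oo] --> `|T i t - S be n i t|.
    by apply: cvg_norm; apply: cvgB; [exact: cvgT|exact: cvg_cst].
  move=> /cvgr_to_le; apply.
  by exists n => // m /= nm; exact: caue.
have cT : pcont T.
  move=> i; apply: (within_continuous_unif_cvg (f_ := fun n => S be n i)) e0 => //.
  by move=> n; exact: cS.
  by move=> n t; exact: TS.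
pose q i t := g i t + -1 * T i t.
have cq : pcont q by apply: pcontD => //; exact: pcontZ.
have rq h : pcont h -> ip (r n) h @[n --> \oo] --> ip q h.
  move=> ch; apply: (ip_unif_cvg _ _ _ _ e0) => //.
  move=> n i t tab; rewrite /r /q.
  rewrite (_ : _ - _ = - (S be n i t - T i t)) ?normrN ?TS//; ring.
have q0 k : ip q (phi k) = 0.
  have h := rq _ (@cphi k); apply/esym/(cvg_unique _ _ h) => //.
  apply: cvg_near_cst; exists k.+1 => // n /= kn.
  by rewrite rphi.
(* Orthogonality of [q] to L g is enough: (r n, L g) equals the energy minus [s n], so its limit 0
   is the claim. *)
have := rq _ cLg; rewrite (complete cq q0)// => h0.
have : ip (L g g2) g - ip (r n) (L g g2) @[n --> \oo] --> ip (L g g2) g - 0.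
  by apply: cvgB => //; exact: cvg_cst.
rewrite subr0; apply: cvg_trans; apply: near_eq_cvg; apply: nearW => n /=.
by rewrite (ipC _ _ (r n)) Lgr opprB addrC subrK.
Qed.

End Spectral.

(** * Test functions *)

Section C1more.
Context {R : realType}.
Implicit Types (a b t : R) (f g F G : R -> R).

Lemma C1_on_ext a b f f1 g g1 : C1_on a b f f1 ->
  (forall t, f t = g t) -> (forall t, f1 t = g1 t) -> C1_on a b g g1.
Proof. by move=> + /funext <- /funext <-. Qed.

Lemma C1_onX a b f f1 n : C1_on a b f f1 ->
  C1_on a b (fun t => f t ^+ n.+1) (fun t => n.+1%:R * f t ^+ n * f1 t).
Proof.
move=> hf; elim: n => [|n IH].
  by apply: C1_on_ext hf _ _ => t; rewrite ?expr1// expr0 !mul1r.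
apply: C1_on_ext (C1_onM hf IH) _ _ => t; first by rewrite -exprS.
by rewrite [f t ^+ n.+1 in RHS]exprS -[n.+2%:R]natr1 exprS; ring.
Qed.

Lemma C1_on_expR a b f f1 : continuous f ->
  (forall t, is_derive t 1 f (f1 t)) -> continuous f1 ->
  C1_on a b (fun t => expR (f t)) (fun t => f1 t * expR (f t)).
Proof.
move=> cf df cf1.
have ce : continuous (fun t => expR (f t)).
  by move=> t; apply: continuous_comp; [exact: cf|exact: continuous_expR].
split; try exact: continuous_subspaceT.
  by apply: continuous_subspaceT => t; apply: cvgM; [exact: cf1|exact: ce].
move=> t _; have hf := df t; have he := is_derive_expR (f t).
have := is_derive1_comp he hf.
by rewrite /= mulrC.
Qed.

Lemma within_continuous_bounded a b f : a <= b ->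
  {within `[a, b], continuous f} ->
  exists2 M, 0 <= M & forall t, a <= t <= b -> `|f t| <= M.
Proof.
move=> ab cf; have [c _ hc] := EVT_max ab (within_continuous_norm cf).
by exists `|f c| => // t tab; apply: hc; rewrite in_itv.
Qed.

(** The right side is (1 - z) times the sum of the z^k for k < n, and each of these n powers is at
    least z^n. This gives the rate 1/n for the sup norm of the correctors. *)
Lemma natr_mul_onem_expr_le (z : R) n : 0 <= z <= 1 ->
  n%:R * ((1 - z) * z ^+ n) <= 1 - z ^+ n.
Proof.
move=> /andP[z0 z1]; elim: n => [|n IH]; first by rewrite mul0r expr0 subrr.
have : z * (n%:R * ((1 - z) * z ^+ n)) <= z * (1 - z ^+ n) by rewrite ler_wpM2l.
have : 0 <= (1 - z) * (1 - z ^+ n.+1).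
  by rewrite mulr_ge0// ?subr_ge0// exprn_ile1.
rewrite -natr1 !exprS; nra.
Qed.

End C1more.

Section Corrector.
Context {R : realType} (a b p e : R).
Hypothesis ab : a < b.
Hypothesis pe : (p = a /\ e = 1) \/ (p = b /\ e = -1).
Implicit Types (n : nat) (t : R).

Let l := b - a.
Let l0 : 0 < l. Proof. by rewrite subr_gt0. Qed.
Let ln0 : l != 0. Proof. by rewrite gt_eqF. Qed.

(* Either [(p, e) = (a, 1)] or [(p, e) = (b, -1)]: [edist] is the distance to
   the end [p].  The function [corr n] vanishes at both ends; among its slopes at
   the ends, directed into the interval, the one at [p] is 1 and the other 0. *)
Definition edist t := e * (t - p).
Definition erel t := 1 - edist t / (b - a).

Local Notation y := edist.
Local Notation z := erel.

Definition corr n t := y t * z t ^+ n.+2.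
Definition corr1 n t :=
  e * (z t ^+ n.+2 - n.+2%:R * (y t / l) * z t ^+ n.+1).
Definition corr2 n t :=
  - (2 * n.+2%:R / l * z t ^+ n.+1) +
  n.+2%:R * n.+1%:R * (y t / l ^+ 2) * z t ^+ n.
(** The sum of the absolute values of the two terms of [corr2]; unlike the absolute value of [corr2]
    itself, it has an elementary primitive. *)
Let maj n t :=
  2 * n.+2%:R / l * z t ^+ n.+1 +
  n.+2%:R * n.+1%:R * (y t / l ^+ 2) * z t ^+ n.

Let ee : e * e = 1.
Proof. by case: pe => [[_ ->]|[_ ->]]; rewrite ?mulr1// mulrNN mulr1. Qed.

Let dy : C1_on a b y (fun=> e).
Proof.
have id1 : C1_on a b (fun t : R => t) (fun=> 1).
  by apply: C1_on_derive => s; exact: cvg_cst.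
apply: C1_on_ext (C1_onZ e (C1_onD id1 (C1_on_cst a b (- p)))) _ _ => t //.
by rewrite addr0 mulr1.
Qed.

Let dz : C1_on a b z (fun=> - (e / l)).
Proof.
apply: C1_on_ext (C1_onD (C1_on_cst a b 1) (C1_onZ (- l^-1) dy)) _ _ => t.
  by rewrite /erel mulNr mulrC.
by rewrite add0r mulNr mulrC.
Qed.

Let cy : {within `[a, b], continuous y}. Proof. by case: dy. Qed.

Let czX n : {within `[a, b], continuous (fun t => z t ^+ n)}.
Proof.
case: n => [|n]; last by have [] := C1_onX n dz.
rewrite (_ : (fun t => _) = fun=> 1); first exact: within_continuous_cst.
by apply/funext => t; rewrite expr0.
Qed.

Lemma C1_corr n : C1_on a b (corr n) (corr1 n).
Proof.
apply: C1_on_ext (C1_onM dy (C1_onX n.+1 dz)) _ _ => t //.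
rewrite /corr1 [z t ^+ n.+2]exprS; ring.
Qed.

Lemma C1_corr1 n : C1_on a b (corr1 n) (corr2 n).
Proof.
apply: C1_on_ext (C1_onZ e (C1_onD (C1_onX n.+1 dz)
  (C1_onZ (- (n.+2%:R / l)) (C1_onM dy (C1_onX n dz))))) _ _ => t.
  by rewrite /corr1; congr (_ * (_ + _)); ring.
rewrite /corr2 exprS; move: (z t ^+ n) (y t) (n.+2%:R) (n.+1%:R) => w v N M.
transitivity ((e * e) * (- (2 * N / l * (z t * w)) + N * M * (v / l ^+ 2) * w)).
  by field.
by rewrite ee mul1r.
Qed.

Let yE t : a <= t <= b -> 0 <= y t <= l.
Proof.
rewrite /edist /l; case: pe => [[-> ->]|[-> ->]] /andP[at_ tb]; apply/andP; split; lra.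
Qed.

Let zE t : a <= t <= b -> 0 <= z t <= 1.
Proof.
move=> /yE /andP[y0 yl]; rewrite /erel; apply/andP; split.
  by rewrite subr_ge0 ler_pdivrMr// mul1r.
by rewrite gerBl divr_ge0// ltW.
Qed.

Let yp : y p = 0. Proof. by rewrite /edist subrr mulr0. Qed.
Let zp : z p = 1. Proof. by rewrite /erel yp mul0r subr0. Qed.

Let aK : a + b - a = b. Proof. by ring. Qed.
Let bK : a + b - b = a. Proof. by ring. Qed.

(* [a + b - p] is the other end of the interval *)
Let yq : y (a + b - p) = l.
Proof. by rewrite /edist /l; case: pe => [[-> ->]|[-> ->]]; ring. Qed.
Let zq : z (a + b - p) = 0.
Proof. by rewrite /erel yq divff ?subrr. Qed.

Lemma corr_end n : corr n a = 0 /\ corr n b = 0.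
Proof.
have h1 : corr n p = 0 by rewrite /corr yp mul0r.
have h2 : corr n (a + b - p) = 0 by rewrite /corr zq exprS mul0r mulr0.
by move: h1 h2; case: pe => [[-> _]|[-> _]]; rewrite ?aK ?bK.
Qed.

Lemma corr1_near n : corr1 n p = e.
Proof. by rewrite /corr1 yp zp mul0r mulr0 mul0r !expr1n subr0 mulr1. Qed.

(** The exponent [n.+2] in [corr] serves here: every term of [corr1] keeps a positive power of [z],
    even for [n] equal to 0. *)
Lemma corr1_far n : corr1 n (a + b - p) = 0.
Proof. by rewrite /corr1 zq !exprS !mul0r !mulr0 subrr mulr0. Qed.

Lemma norm_corr_le n t : a <= t <= b -> `|corr n t| <= l / n.+1%:R.
Proof.
move=> tab; have /andP[y0 yl] := yE tab; have /andP[z0 z1] := zE tab.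
rewrite ger0_norm; last by apply: mulr_ge0 => //; exact: exprn_ge0.
have yz : y t = l * (1 - z t) by rewrite /erel -/l; field.
rewrite /corr yz -mulrA ler_pM2l// -[leRHS]mul1r ler_pdivlMr// mulrC.
apply: le_trans (_ : n.+2%:R * ((1 - z t) * z t ^+ n.+2) <= _).
  apply: ler_wpM2r; last by rewrite ler_nat.
  apply: mulr_ge0; last exact: exprn_ge0.
  by rewrite subr_ge0.
apply: le_trans (natr_mul_onem_expr_le _ (zE tab)) _.
by rewrite gerBl exprn_ge0.
Qed.

Let cmaj n : {within `[a, b], continuous (maj n)}.
Proof.
apply: within_continuousD; apply: within_continuousM => //.
  exact: within_continuous_cst.
apply: within_continuousM; first exact: within_continuous_cst.
by apply: within_continuousM => //; exact: within_continuous_cst.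
Qed.

Let corr2_le n t : a <= t <= b -> `|corr2 n t| <= maj n t.
Proof.
move=> tab; have /andP[y0 yl] := yE tab; have /andP[z0 z1] := zE tab.
have h1 : 0 <= 2 * n.+2%:R / l * z t ^+ n.+1.
  by apply: mulr_ge0; [apply: divr_ge0 => //; exact: ltW|exact: exprn_ge0].
have h2 : 0 <= n.+2%:R * n.+1%:R * (y t / l ^+ 2) * z t ^+ n.
  apply: mulr_ge0; last exact: exprn_ge0.
  by apply: mulr_ge0 => //; apply: divr_ge0 => //; rewrite exprn_ge0// ltW.
by apply: le_trans (ler_normD _ _) _; rewrite normrN !ger0_norm.
Qed.

Let itg_edist F f : C1_on a b (fun t => e * F t) f ->
  itg a b f = F (a + b - p) - F p.
Proof.
move=> h; rewrite (itg_C1 ab h).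
by case: pe => [[-> ->]|[-> ->]]; rewrite ?aK ?bK; ring.
Qed.

(** In the variable [y] both terms are Beta integrals; they contribute 2 and 1. *)
Let itg_maj n : itg a b (maj n) = 3.
Proof.
rewrite (@itg_edist (fun t => - (3 * z t ^+ n.+2 + n.+2%:R / l * (y t * z t ^+ n.+1)))).
  rewrite zq zp yp !exprS !mul0r !mulr0 !expr1n; ring.
apply: C1_on_ext (C1_onZ (- e) (C1_onD (C1_onZ 3 (C1_onX n.+1 dz))
  (C1_onZ (n.+2%:R / l) (C1_onM dy (C1_onX n dz))))) _ _ => t; first by ring.
rewrite /maj exprS; move: (z t ^+ n) (y t) (n.+2%:R) (n.+1%:R) => w v N M.
transitivity ((e * e) * (2 * N / l * (z t * w) + N * M * (v / l ^+ 2) * w)).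
  by field.
by rewrite ee mul1r.
Qed.

(** Each of the two terms contributes the Beta integral 2 l / (n + 3). The primitive comes from
    integrating by parts: [y] times the primitive used in [itg_maj], minus a primitive of the
    latter. *)
Let itg_edist_maj n : itg a b (fun t => y t * maj n t) = 4 * l / n.+3%:R.
Proof.
have n3 : n.+3%:R != 0 :> R by rewrite pnatr_eq0.
rewrite (@itg_edist (fun t =>
   - (y t * (3 * z t ^+ n.+2 + n.+2%:R / l * (y t * z t ^+ n.+1)))
   - y t * z t ^+ n.+2 - 4 * l / n.+3%:R * z t ^+ n.+3)).
  rewrite zq zp yp !exprS !mul0r !mulr0 !expr1n; ring.
have h1 := C1_onM dy (C1_onD (C1_onZ 3 (C1_onX n.+1 dz))
  (C1_onZ (n.+2%:R / l) (C1_onM dy (C1_onX n dz)))).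
have h2 := C1_onM dy (C1_onX n.+1 dz).
have h3 := C1_onZ (4 * l / n.+3%:R) (C1_onX n.+2 dz).
apply: C1_on_ext (C1_onZ (- e) (C1_onD (C1_onD h1 h2) h3)) _ _ => t.
  by ring.
rewrite /maj [z t ^+ n.+2]exprS exprS.
move: (z t ^+ n) (y t) (n.+3%:R) (n.+2%:R) (n.+1%:R) n3 => w v K N M n3.
transitivity ((e * e) * (v * (2 * N / l * (z t * w) + N * M * (v / l ^+ 2) * w))).
  by field; rewrite ln0 n3.
by rewrite ee mul1r.
Qed.

Lemma ccorr2 n : {within `[a, b], continuous (corr2 n)}.
Proof. by case: (C1_corr1 n). Qed.

Lemma itg_norm_corr2 n : itg a b (fun t => `|corr2 n t|) <= 3.
Proof.
rewrite -(itg_maj n); apply: le_itg => //.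
- apply: within_continuous_norm; exact: ccorr2.
- exact: corr2_le.
Qed.

Let itg_corr2 n : itg a b (corr2 n) = -1.
Proof.
rewrite (itg_C1 ab (C1_corr1 n)); have := corr1_near n; have := corr1_far n.
by case: pe => [[-> ->]|[-> ->]]; rewrite ?aK ?bK => -> ->; rewrite ?sub0r ?subr0.
Qed.

(* The kernels [- corr2 n] have mass 1, bounded L^1 norm and a first moment
   that tends to 0: they form an approximation of the Dirac mass at [p]. *)
Lemma itg_corr2_cvg h : {within `[a, b], continuous h} ->
  itg a b (fun t => corr2 n t * h t) @[n --> \oo] --> - h p.
Proof.
move=> ch; have [M M0 hM] := within_continuous_bounded (ltW ab) ch.
have pab : a <= p <= b.
  by case: pe => [[-> _]|[-> _]]; rewrite lexx ltW.
apply/cvgrPdist_le => /= eps eps0.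
have eps4 : 0 < eps / 4 by rewrite divr_gt0.
have [d d0 hd] : exists2 d : R, 0 < d & forall t, a <= t <= b -> y t < d ->
    `|h t - h p| <= eps / 4.
  have /subspace_continuousP/(_ p)/= := ch.
  rewrite in_itv/= => /(_ pab)/cvgrPdist_le/(_ _ eps4).
  rewrite near_withinE/= => -[d /= d0 hd]; exists d => // t tab ytd.
  rewrite distrC; apply: hd; last by rewrite /= in_itv.
  rewrite /ball_/= distrC (_ : `|t - p| = y t)//.
  have /andP[y0 _] := yE tab; rewrite -(ger0_norm y0) /edist normrM.
  by case: pe => [[_ ->]|[_ ->]]; rewrite ?normrN1 ?normr1 mul1r.
(* Continuity of [h] at [p] is turned into the affine bound [hB] in the distance to [p]: near [p]
   the constant term suffices, and beyond distance [d] the slope [B] absorbs the trivial bound 2 M.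
   Only the mass and the first moment of [maj] are then needed. *)
pose B := 2 * M / d.
have B0 : 0 <= B by rewrite divr_ge0 ?mulr_ge0// ltW.
have hB t : a <= t <= b -> `|h t - h p| <= eps / 4 + B * y t.
  move=> tab; have /andP[y0 yl] := yE tab.
  have [ytd|dyt] := ltP (y t) d.
    by apply: le_trans (hd _ tab ytd) _; rewrite lerDl mulr_ge0.
  apply: (@le_trans _ _ (2 * M)).
    apply: le_trans (ler_normB _ _) _.
    by have := hM _ tab; have := hM _ pab; lra.
  have : B * d <= B * y t by rewrite ler_wpM2l.
  rewrite /B divfK ?gt_eqF// => ?; have := ltW eps4; lra.
have cK n : {within `[a, b], continuous (fun t => corr2 n t * (h t + - h p))}.
  apply: within_continuousM; first exact: ccorr2.
  by apply: within_continuousD => //; exact: within_continuous_cst.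
have cB n : {within `[a, b], continuous
    (fun t => eps / 4 * maj n t + B * (y t * maj n t))}.
  by apply: within_continuousD; apply: within_continuousZ => //;
    exact: within_continuousM.
have est n : `|- h p - itg a b (fun t => corr2 n t * h t)| <=
    eps / 4 * 3 + B * (4 * l / n.+3%:R).
  have -> : - h p - itg a b (fun t => corr2 n t * h t) =
      - itg a b (fun t => corr2 n t * (h t + - h p)).
    have -> : itg a b (fun t => corr2 n t * (h t + - h p)) =
        itg a b (fun t => corr2 n t * h t + - h p * corr2 n t).
      by apply: eq_itg => t _; ring.
    rewrite itgD; first last.
      by apply: within_continuousZ; exact: ccorr2.
      by apply: within_continuousM => //; exact: ccorr2.
    rewrite itgZ; last exact: ccorr2.
    by rewrite itg_corr2; ring.
  rewrite normrN; apply: le_trans (le_norm_itg (@cK n)) _.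
  have -> : eps / 4 * 3 + B * (4 * l / n.+3%:R) =
      itg a b (fun t => eps / 4 * maj n t + B * (y t * maj n t)).
    rewrite itgD; first last.
      by apply: within_continuousZ => //; exact: within_continuousM.
      exact: within_continuousZ.
    rewrite !itgZ//; last exact: within_continuousM.
    by rewrite itg_maj itg_edist_maj.
  apply: le_itg => //; first by apply: within_continuous_norm; exact: cK.
  move=> t tab; rewrite normrM.
  have -> : eps / 4 * maj n t + B * (y t * maj n t) =
      maj n t * (eps / 4 + B * y t) by ring.
  by apply: ler_pM => //; [exact: corr2_le|exact: hB].
have : (fun n => B * (4 * l) * n.+3%:R^-1) @ \oo --> 0.
  rewrite -[X in _ --> X](mulr0 (B * (4 * l))); apply: cvgMl_tmp.
  rewrite (_ : (fun n => _) = fun n => @harmonic R (n + 2)%N); last first.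
    by apply/funext => n; rewrite /harmonic/= addn2.
  by rewrite (cvg_shiftn 2 (@harmonic R)); exact: cvg_harmonic.
move=> /cvgr0Pnorm_le/(_ _ eps4); apply: filterS => n hn.
apply: le_trans (est n) _.
have : B * (4 * l / n.+3%:R) <= eps / 4.
  by apply: le_trans hn; rewrite mulrA ler_norm.
by move: (B * _) => w; lra.
Qed.

End Corrector.

(** * Test functions with prescribed vertex values *)

Section TestFunctions.
Context {R : realType} {I V : finType} (a b : I -> R) (src tgt : I -> V).
Hypothesis ab : forall i, a i < b i.
Context (kappa : R).
Hypothesis kappa0 : 0 < kappa.
Context (c : V -> R).

Local Notation ip := (ip a b).
Local Notation L := (Lop kappa).
Local Notation dom := (dom a b src tgt).
Local Notation pcont := (pcont a b).

Definition decay i : R := expR (- kappa * (b i - a i)).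
Local Notation q := decay.

Lemma decay_bounds i : 0 < q i < 1.
Proof.
rewrite /decay expR_gt0/= -expR0 ltr_expR mulNr oppr_lt0 mulr_gt0//.
by rewrite subr_gt0.
Qed.

Let q2 i : 1 - q i ^+ 2 != 0.
Proof.
have /andP[q0 q1] := decay_bounds i.
by rewrite gt_eqF// subr_gt0 expr_lt1// ltW.
Qed.

(** [A] and [B] solve the end conditions A + q B = c(src), q A + B = c(tgt) for a combination of the
    exponentials decaying from either end. *)
Let A i := (c (src i) - q i * c (tgt i)) / (1 - q i ^+ 2).
Let B i := (c (tgt i) - q i * c (src i)) / (1 - q i ^+ 2).

Definition hyp i t :=
  A i * expR (- kappa * edist (a i) 1 t) + B i * expR (- kappa * edist (b i) (-1) t).
Definition hyp1 i t :=
  A i * (- kappa * expR (- kappa * edist (a i) 1 t)) +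
  B i * (kappa * expR (- kappa * edist (b i) (-1) t)).

(* the derivatives of [hyp i] at both ends, in the direction pointing into
   the edge *)
Definition slope_src i := hyp1 i (a i).
Definition slope_tgt i := - hyp1 i (b i).

(** The coefficients are hyperbolic functions in disguise: (1 + q^2) / (1 - q^2) = coth(kappa l) and
    2 q / (1 - q^2) = 1 / sinh(kappa l), where l is the length of the piece. They reappear in the
    entries of the precision matrix. *)
Lemma slope_srcE i : slope_src i =
  - (kappa * ((1 + q i ^+ 2) * c (src i) - 2 * q i * c (tgt i)) / (1 - q i ^+ 2)).
Proof.
rewrite /slope_src /hyp1 /edist subrr !mulr0 expR0.
have -> : - kappa * (-1 * (a i - b i)) = - kappa * (b i - a i) by ring.
by rewrite -/(q i) /A /B; field.
Qed.

Lemma slope_tgtE i : slope_tgt i =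
  - (kappa * ((1 + q i ^+ 2) * c (tgt i) - 2 * q i * c (src i)) / (1 - q i ^+ 2)).
Proof.
rewrite /slope_tgt /hyp1 /edist subrr !mulr0 expR0 mul1r.
by rewrite -/(q i) /A /B; field.
Qed.

Let hyp_src i : hyp i (a i) = c (src i).
Proof.
rewrite /hyp /edist subrr !mulr0 expR0.
have -> : - kappa * (-1 * (a i - b i)) = - kappa * (b i - a i) by ring.
by rewrite -/(q i) /A /B; field.
Qed.

Let hyp_tgt i : hyp i (b i) = c (tgt i).
Proof.
rewrite /hyp /edist subrr !mulr0 expR0 mul1r.
by rewrite -/(q i) /A /B; field.
Qed.

Let C1_exp (p e x y : R) : C1_on x y (fun t => expR (- kappa * edist p e t))
  (fun t => - kappa * e * expR (- kappa * edist p e t)).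
Proof.
have d (t : R) : is_derive t 1 (fun t => - kappa * edist p e t) (- kappa * e).
  have -> : (fun t => - kappa * edist p e t) =
      (fun t => (- kappa * e) *: t + (kappa * e * p)).
    by apply/funext => s; rewrite /edist [_ *: _]/GRing.scale/=; ring.
  by apply: is_derive_eq; rewrite addr0 /GRing.scale/= mulr1.
apply: C1_on_expR => //; last by move=> t; exact: cvg_cst.
by move=> t; apply/differentiable_continuous/derivable1_diffP; case: (d t).
Qed.

Let dhyp i : C1_on (a i) (b i) (hyp i) (hyp1 i).
Proof.
apply: C1_on_ext (C1_onD (C1_onZ (A i) (C1_exp (a i) 1 _ _))
  (C1_onZ (B i) (C1_exp (b i) (-1) _ _))) _ _ => t //.
by rewrite /hyp1; ring.
Qed.

Let dhyp1 i : C1_on (a i) (b i) (hyp1 i) (fun t => kappa ^+ 2 * hyp i t).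
Proof.
apply: C1_on_ext (C1_onD (C1_onZ (A i * - kappa) (C1_exp (a i) 1 _ _))
  (C1_onZ (B i * kappa) (C1_exp (b i) (-1) _ _))) _ _ => t.
  by rewrite /hyp1; ring.
by rewrite /hyp; ring.
Qed.

Let pea i : (a i = a i /\ 1 = 1 :> R) \/ (a i = b i /\ 1 = -1 :> R).
Proof. by left. Qed.
Let peb i : (b i = a i /\ -1 = 1 :> R) \/ (b i = b i /\ -1 = -1 :> R).
Proof. by right. Qed.

Local Notation ca i := (corr (a i) (b i) (a i) 1).
Local Notation cb i := (corr (a i) (b i) (b i) (-1)).
Local Notation ca1 i := (corr1 (a i) (b i) (a i) 1).
Local Notation cb1 i := (corr1 (a i) (b i) (b i) (-1)).
Local Notation ca2 i := (corr2 (a i) (b i) (a i) 1).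
Local Notation cb2 i := (corr2 (a i) (b i) (b i) (-1)).

(* [hyp] solves [L hyp = 0] with vertex values [c]; after the correction all
   derivatives vanish at the ends, so Kirchhoff's conditions hold trivially. *)
Definition test n i t :=
  hyp i t + (- slope_src i * ca i n t + - slope_tgt i * cb i n t).
Definition test1 n i t :=
  hyp1 i t + (- slope_src i * ca1 i n t + - slope_tgt i * cb1 i n t).
Definition test2 n i t :=
  kappa ^+ 2 * hyp i t + (- slope_src i * ca2 i n t + - slope_tgt i * cb2 i n t).

Let test1_src n i : test1 n i (a i) = 0.
Proof.
rewrite /test1 corr1_near.
have := corr1_far (ab i) (peb i) n; rewrite addrK => ->.
by rewrite -/(slope_src i); ring.
Qed.

Let test1_tgt n i : test1 n i (b i) = 0.
Proof.
rewrite /test1 corr1_near.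
have := corr1_far (ab i) (pea i) n; rewrite addrAC subrr add0r => ->.
by rewrite /slope_tgt; ring.
Qed.

Lemma dom_test n : dom (test n) (test1 n) (test2 n).
Proof.
split.
- move=> i; apply: C1_onD; first exact: dhyp.
  apply: C1_onD; apply: C1_onZ.
    exact: C1_corr.
  exact: C1_corr.
- move=> i; apply: C1_onD; first exact: dhyp1.
  apply: C1_onD; apply: C1_onZ.
    exact: (C1_corr1 (ab i) (pea i) n).
  exact: (C1_corr1 (ab i) (peb i) n).
- exists c => i; rewrite /test.
  have [-> ->] := corr_end (ab i) (pea i) n.
  have [-> ->] := corr_end (ab i) (peb i) n.
  by rewrite hyp_src hyp_tgt; split; ring.
- move=> v; rewrite big1 => [|i _]; last exact: test1_src.
  by rewrite big1 ?subrr// => i _; exact: test1_tgt.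
Qed.

(** L annihilates [hyp], so only the correctors remain: their second derivatives approximate Dirac
    masses at the ends, and the zeroth-order terms vanish uniformly. *)
Let LtestE n i t : L (test n) (test2 n) i t =
  slope_src i * ca2 i n t + slope_tgt i * cb2 i n t +
  - kappa ^+ 2 * (slope_src i * ca i n t + slope_tgt i * cb i n t).
Proof. by rewrite /Lop /test /test2; ring. Qed.

Let l1 i := b i - a i.
Let l1_gt0 i : 0 < l1 i. Proof. by rewrite subr_gt0. Qed.

Let cca n i : {within `[a i, b i], continuous ca i n}.
Proof. by case: (C1_corr (a i) (b i) (a i) 1 n). Qed.
Let ccb n i : {within `[a i, b i], continuous cb i n}.
Proof. by case: (C1_corr (a i) (b i) (b i) (-1) n). Qed.
Let cca2 n i : {within `[a i, b i], continuous ca2 i n}.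
Proof. exact: (ccorr2 (ab i) (pea i)). Qed.
Let ccb2 n i : {within `[a i, b i], continuous cb2 i n}.
Proof. exact: (ccorr2 (ab i) (peb i)). Qed.

Let itg_corr_cvg (k : nat -> R -> R) i h :
  (forall n, {within `[a i, b i], continuous (k n)}) ->
  (forall n t, a i <= t <= b i -> `|k n t| <= l1 i / n.+1%:R) ->
  {within `[a i, b i], continuous h} ->
  itg (a i) (b i) (fun t => k n t * h t) @[n --> \oo] --> 0.
Proof.
move=> ck kle ch; have cnh := within_continuous_norm ch.
apply: (@cvg_dist_le _ _
  (fun n => l1 i * itg (a i) (b i) (fun t => `|h t|) * n.+1%:R^-1)).
  move=> n; rewrite subr0.
  have ckh := within_continuousM (ck n) ch.
  apply: le_trans (le_norm_itg ckh) _.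
  rewrite mulrAC -itgZ//; apply: le_itg.
  - exact: within_continuous_norm.
  - exact: within_continuousZ.
  - by move=> t tab; rewrite normrM ler_wpM2r// kle.
rewrite -[X in _ --> X](mulr0 (l1 i * itg (a i) (b i) (fun t => `|h t|))).
by apply: cvgMl_tmp; exact: cvg_harmonic.
Qed.

Lemma ip_test_cvg h : pcont h ->
  ip (L (test n) (test2 n)) h @[n --> \oo] -->
  \sum_i (- slope_src i * h i (a i) + - slope_tgt i * h i (b i)).
Proof.
move=> ch; apply: cvg_big => [|i _]; first exact: add_continuous.
have cM (k : nat -> R -> R) n : {within `[a i, b i], continuous (k n)} ->
    {within `[a i, b i], continuous (fun t => k n t * h i t)}.
  by move=> ck; exact: within_continuousM.
have -> : (fun n => itg (a i) (b i) (fun t => L (test n) (test2 n) i t * h i t)) =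
    (fun n => slope_src i * itg (a i) (b i) (fun t => ca2 i n t * h i t) +
      slope_tgt i * itg (a i) (b i) (fun t => cb2 i n t * h i t) +
      - kappa ^+ 2 * (slope_src i * itg (a i) (b i) (fun t => ca i n t * h i t) +
      slope_tgt i * itg (a i) (b i) (fun t => cb i n t * h i t))).
  apply/funext => n.
  have c1 := cM (fun n => ca2 i n) n (@cca2 n i).
  have c2 := cM (fun n => cb2 i n) n (@ccb2 n i).
  have c3 := cM (fun n => ca i n) n (@cca n i).
  have c4 := cM (fun n => cb i n) n (@ccb n i).
  have z1 := within_continuousZ (c := (slope_src i)) c1.
  have z2 := within_continuousZ (c := (slope_tgt i)) c2.
  have z3 := within_continuousZ (c := (slope_src i)) c3.
  have z4 := within_continuousZ (c := (slope_tgt i)) c4.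
  have z12 := within_continuousD z1 z2; have z34 := within_continuousD z3 z4.
  have z5 := within_continuousZ (c := (- kappa ^+ 2)) z34.
  rewrite -(itgZ _ c1) -(itgZ _ c2) -(itgZ _ c3) -(itgZ _ c4).
  rewrite -(itgD z1 z2) -(itgD z3 z4) -(itgZ _ z34) -(itgD z12 z5).
  by apply: eq_itg => t _; rewrite LtestE; ring.
have -> : - slope_src i * h i (a i) + - slope_tgt i * h i (b i) =
   slope_src i * - h i (a i) + slope_tgt i * - h i (b i) +
   - kappa ^+ 2 * (slope_src i * 0 + slope_tgt i * 0) by ring.
apply: cvgD; first (apply: cvgD; apply: cvgMl_tmp).
- exact: (itg_corr2_cvg (ab i) (pea i) (@ch i)).
- exact: (itg_corr2_cvg (ab i) (peb i) (@ch i)).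
apply: cvgMl_tmp; apply: cvgD; apply: cvgMl_tmp; apply: itg_corr_cvg => //.
- by move=> n t; exact: (norm_corr_le (ab i) (pea i)).
- by move=> n t; exact: (norm_corr_le (ab i) (peb i)).
Qed.

(** The total derivative of [hyp] at [v] in the directions leaving the pieces; a loop contributes
    through both of its ends. *)
Definition flux v :=
  \sum_(i | src i == v) - slope_src i + \sum_(i | tgt i == v) - slope_tgt i.

Lemma flux_dot (val : V -> R) :
  \sum_v flux v * val v =
  \sum_i (- slope_src i * val (src i) + - slope_tgt i * val (tgt i)).
Proof.
under eq_bigr do rewrite mulrDl; rewrite big_split/= [RHS]big_split/=.
congr (_ + _).
  rewrite [RHS](partition_big src xpredT)//=; apply: eq_bigr => v _.
  by rewrite mulr_suml; apply: eq_bigr => i /eqP <-.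
rewrite [RHS](partition_big tgt xpredT)//=; apply: eq_bigr => v _.
by rewrite mulr_suml; apply: eq_bigr => i /eqP <-.
Qed.

Lemma ip_test_cvg_flux h (val : V -> R) : pcont h ->
  (forall i, h i (a i) = val (src i) /\ h i (b i) = val (tgt i)) ->
  ip (L (test n) (test2 n)) h @[n --> \oo] --> \sum_v flux v * val v.
Proof.
move=> ch hv; rewrite flux_dot.
under eq_bigr => i _ do rewrite -(hv i).1 -(hv i).2.
exact: ip_test_cvg.
Qed.

Let S i := `|slope_src i| + `|slope_tgt i|.
Let K := \sum_i S i * l1 i.

Let S_ge0 i : 0 <= S i. Proof. by rewrite addr_ge0. Qed.

Let test_hyp_le n i t : a i <= t <= b i -> `|test n i t - hyp i t| <= K / n.+1%:R.
Proof.
move=> tab; rewrite /test addrC addKr.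
apply: (@le_trans _ _ (S i * l1 i / n.+1%:R)).
  rewrite /S -mulrA mulrDl; apply: le_trans (ler_normD _ _) _.
  apply: lerD; rewrite normrM normrN ler_wpM2l//.
  - exact: (norm_corr_le (ab i) (pea i)).
  - exact: (norm_corr_le (ab i) (peb i)).
rewrite ler_wpM2r// /K (bigD1 i)//= lerDl sumr_ge0// => j _.
by rewrite mulr_ge0// ltW.
Qed.

Let K_ge0 : 0 <= K.
Proof. by apply: sumr_ge0 => i _; rewrite mulr_ge0// ltW. Qed.

Let M := \sum_i (3 * S i + kappa ^+ 2 * (S i * l1 i) * l1 i).

Let L1norm_Ltest n : L1norm a b (L (test n) (test2 n)) <= M.
Proof.
apply: ler_sum => i _.
have cL := pcont_Lop (kappa := kappa) (dom_test n).
have na2 := within_continuous_norm (@cca2 n i).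
have nb2 := within_continuous_norm (@ccb2 n i).
have z1 := within_continuousZ (c := `|slope_src i|) na2.
have z2 := within_continuousZ (c := `|slope_tgt i|) nb2.
have z12 := within_continuousD z1 z2.
have z3 := @within_continuous_cst R (a i) (b i) (kappa ^+ 2 * (S i * l1 i)).
apply: (@le_trans _ _ (itg (a i) (b i) (fun t =>
    `|slope_src i| * `|ca2 i n t| + `|slope_tgt i| * `|cb2 i n t| +
    kappa ^+ 2 * (S i * l1 i)))).
  apply: le_itg; first by apply: within_continuous_norm; exact: cL.
    exact: within_continuousD z12 z3.
  move=> t tab; rewrite LtestE; apply: le_trans (ler_normD _ _) _.
  apply: lerD.
    by apply: le_trans (ler_normD _ _) _; rewrite !normrM.
  have kk : `|- kappa ^+ 2| = kappa ^+ 2 by rewrite normrN ger0_norm ?sqr_ge0.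
  rewrite normrM kk; apply: ler_wpM2l; first exact: sqr_ge0.
  apply: le_trans (ler_normD _ _) _.
  rewrite (normrM (slope_src i)) (normrM (slope_tgt i)) /S mulrDl.
  have h1 := norm_corr_le (ab i) (pea i) n tab.
  have h2 := norm_corr_le (ab i) (peb i) n tab.
  have le1 : (b i - a i) / n.+1%:R <= l1 i.
    rewrite ler_pdivrMr// ler_peMr ?ler1n// ltW//; exact: l1_gt0.
  by apply: lerD; rewrite ler_wpM2l//; exact: le_trans le1.
rewrite (itgD z12 z3) (itgD z1 z2) (itgZ _ na2) (itgZ _ nb2).
apply: lerD.
  rewrite [3 * _]mulrC /S mulrDl; apply: lerD; rewrite ler_wpM2l//.
  - exact: (itg_norm_corr2 (ab i) (pea i)).
  - exact: (itg_norm_corr2 (ab i) (peb i)).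
rewrite /itg Rintegral_cst//= lebesgue_measure_itv/= lte_fin ab/=.
by [].
Qed.

Let M_ge0 : 0 <= M.
Proof. exact: le_trans (L1norm_ge0 _ _ _) (L1norm_Ltest 0). Qed.

(** [hyp] may violate Kirchhoff's conditions, but it is continuous with vertex values [c], so
    pairing with it has the stated limit. Replacing it by [test n] costs at most the sup norm of the
    difference times the L^1 norm of L (test n), that is K M / (n + 1). *)
Lemma energy_test_cvg :
  ip (L (test n) (test2 n)) (test n) @[n --> \oo] --> \sum_v flux v * c v.
Proof.
have chyp : pcont hyp by move=> i; case: (dhyp i).
have cL n := pcont_Lop (kappa := kappa) (dom_test n).
have ct n : pcont (test n) by have [] := dom_pcont (dom_test n).
have h1 : ip (L (test n) (test2 n)) hyp @[n --> \oo] --> \sum_v flux v * c v.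
  by apply: ip_test_cvg_flux => // i; rewrite hyp_src hyp_tgt.
have h2 : ip (L (test n) (test2 n)) (fun i t => test n i t + -1 * hyp i t)
    @[n --> \oo] --> 0.
  apply: (@cvg_dist_le _ _ (fun n => K * M * n.+1%:R^-1)).
    move=> n; rewrite subr0 ipC.
    apply: le_trans (_ : K / n.+1%:R * L1norm a b (L (test n) (test2 n)) <= _).
      apply: norm_ip_le => //; first by apply: pcontD => //; exact: pcontZ.
      by move=> i t tab; rewrite mulN1r test_hyp_le.
    rewrite mulrAC ler_wpM2r// ler_wpM2l//; exact: L1norm_Ltest.
  rewrite -[X in _ --> X](mulr0 (K * M)); apply: cvgMl_tmp.
  exact: cvg_harmonic.
rewrite -[X in _ --> X]addr0.
rewrite (_ : (fun n => ip _ _) = fun n => ip (L (test n) (test2 n)) hyp +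
    ip (L (test n) (test2 n)) (fun i t => test n i t + -1 * hyp i t)).
  exact: cvgD.
have cz : pcont (fun i t => -1 * hyp i t) by exact: pcontZ.
apply/funext => n; rewrite (ipDr (@ct n) cz (@cL n)) (ipZr _ chyp (@cL n)).
by ring.
Qed.

(** The same pairing of sup and L^1 norms, applied to the difference of two test functions: its sup
    norm is at most K (1/(n+1) + 1/(m+1)), and L of it has L^1 norm at most 2 M. *)
Lemma energy_test_sub : exists C : R, forall n m,
  ip (L (fun i t => test n i t + -1 * test m i t)
        (fun i t => test2 n i t + -1 * test2 m i t))
     (fun i t => test n i t + -1 * test m i t) <= C * (n.+1%:R^-1 + m.+1%:R^-1).
Proof.
exists (2 * M * K) => n m.
have cL n' := pcont_Lop (kappa := kappa) (dom_test n').
have dnm := dom_lin (-1) (dom_test n) (dom_test m).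
have [cnm _ _] := dom_pcont dnm.
have nm i t : a i <= t <= b i ->
    `|test n i t + -1 * test m i t| <= K * (n.+1%:R^-1 + m.+1%:R^-1).
  move=> tab; rewrite mulN1r.
  have -> : test n i t - test m i t =
    (test n i t - hyp i t) - (test m i t - hyp i t) by ring.
  by rewrite mulrDr; apply: le_trans (ler_normB _ _) (lerD _ _); exact: test_hyp_le.
apply: le_trans (ler_norm _) _.
rewrite (_ : ip _ _ = ip (fun i t => test n i t + -1 * test m i t)
    (L (test n) (test2 n)) + -1 * ip (fun i t => test n i t + -1 * test m i t)
    (L (test m) (test2 m))); last first.
  have cz : pcont (fun i t => -1 * L (test m) (test2 m) i t) by exact: pcontZ.
  rewrite -(ipZr _ (@cL m) cnm) -(ipDr (@cL n) cz cnm).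
  by rewrite ipC; apply: eq_ip => // i t _; rewrite /Lop; ring.
rewrite mulN1r; apply: le_trans (ler_normB _ _) _.
have e0 : 0 <= K * (n.+1%:R^-1 + m.+1%:R^-1) by rewrite mulr_ge0// addr_ge0.
have bd n' : `|ip (fun i t => test n i t + -1 * test m i t) (L (test n') (test2 n'))|
    <= K * (n.+1%:R^-1 + m.+1%:R^-1) * M.
  apply: le_trans (norm_ip_le cnm (cL n') nm) _.
  by rewrite ler_wpM2l//; exact: L1norm_Ltest.
apply: le_trans (lerD (bd n) (bd m)) _.
by rewrite le_eqVlt; apply/orP; left; apply/eqP; ring.
Qed.

End TestFunctions.

(** * Square-integrable functions on the graph *)

Section L2Interval.
Context {R : realType}.
Implicit Types (l : R) (f g h : R -> R).

Lemma lebesgue_itv_lty (a b : R) : (mu `[a, b]%classic < +oo)%E.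
Proof.
rewrite lebesgue_measure_itv/=; case: ifPn => // _.
by rewrite -EFinB ltry.
Qed.

Lemma bounded_L2_itv l h (M : R) : measurable_fun `[0, l] h ->
  (forall t, 0 <= t <= l -> `|h t| <= M) -> L2_itv l h.
Proof.
move=> mh hM; split => //.
apply: (@measurable_bounded_integrable _ _ _ mu (fun t => h t ^+ 2)) => //.
- exact: lebesgue_itv_lty.
- exact: measurable_funX.
- exists (M ^+ 2); split; rewrite ?num_real// => x Mx t /=; rewrite in_itv/= => tl.
  apply: le_trans (ltW Mx); rewrite normrX lerXn2r ?nnegrE//; last exact: hM.
  exact: le_trans (hM _ tl).
Qed.

Lemma continuous_L2_itv l h : 0 <= l -> {within `[0, l], continuous h} -> L2_itv l h.
Proof.
move=> l0 ch; have [M _ hM] := within_continuous_bounded l0 ch.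
apply: bounded_L2_itv hM; apply/measurable_EFinP.
by have /measurable_int := within_continuous_integrable ch.
Qed.

Lemma L2_itvM l h g : L2_itv l h -> L2_itv l g ->
  mu.-integrable `[0, l] (EFin \o (fun t => h t * g t)).
Proof.
move=> [mh ih] [mg ig].
apply: (@le_integrable _ _ _ mu _ _ _
  (fun t => ((h t) ^+ 2)%:E + ((g t) ^+ 2)%:E)%E) => //.
- exact/measurable_EFinP/measurable_funM.
- move=> t _; rewrite -EFinD !abse_EFin lee_fin.
  rewrite [leRHS]ger0_norm ?addr_ge0 ?sqr_ge0// normrM.
  rewrite -(real_normK (num_real (h t))) -(real_normK (num_real (g t))).
  have := sqr_ge0 (`|h t| - `|g t|); rewrite sqrrB.
  have : 0 <= `|h t| * `|g t| by rewrite mulr_ge0.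
  by rewrite -mulr_natl; lra.
- exact: integrableD.
Qed.

Lemma L2_itvZ l c h : L2_itv l h -> L2_itv l (fun t => c * h t).
Proof.
move=> [mh ih]; split.
  by apply: measurable_funM => //; exact: measurable_cst.
have : mu.-integrable `[0, l] (fun t => ((c ^+ 2)%:E * ((h t) ^+ 2)%:E)%E).
  exact: integrableZl.
congr (is_true (mu.-integrable _ _)); apply/funext => t /=.
by rewrite -EFinM -exprMn.
Qed.

Lemma L2_itvD l h g : L2_itv l h -> L2_itv l g -> L2_itv l (fun t => h t + g t).
Proof.
move=> h2 g2; have := L2_itvM h2 g2; move: h2 g2 => [mh ih] [mg ig] ihg.
split; first exact: measurable_funD.
have : mu.-integrable `[0, l] (fun t =>
    ((h t) ^+ 2)%:E + ((g t) ^+ 2)%:E + 2%:E * (h t * g t)%:E)%E.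
  by apply: integrableD => //; [exact: integrableD|exact: integrableZl].
congr (is_true (mu.-integrable _ _)); apply/funext => t /=.
by rewrite -!EFinM -!EFinD; congr _%:E; ring.
Qed.

Lemma L2_itv0 l : L2_itv l (fun=> 0).
Proof.
split; first exact: measurable_cst.
have : mu.-integrable `[0, l] (fun _ : R => 0%E) by exact: integrable0.
by congr (is_true (mu.-integrable _ _)); apply/funext => t; rewrite expr0n.
Qed.

End L2Interval.

Section L2Graph.
Context {R : realType} (G : metric_graph R).
Implicit Types (f g h : gedge G -> R -> R).

Lemma L2Z c h : L2 h -> L2 (fun e t => c * h e t).
Proof. by move=> h2 e; exact: L2_itvZ. Qed.

Lemma L2D h g : L2 h -> L2 g -> L2 (fun e t => h e t + g e t).
Proof. by move=> h2 g2 e; exact: L2_itvD. Qed.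

Lemma L2_sum (c : nat -> R) (h : nat -> gedge G -> R -> R) n :
  (forall k, L2 (h k)) -> L2 (fun e t => \sum_(k < n) c k * h k e t).
Proof.
move=> h2; elim: n => [|n IH].
  move=> e; have -> : (fun t => \sum_(k < 0) c k * h k e t) = fun=> 0.
    by apply/funext => t; rewrite big_ord0.
  exact: L2_itv0.
move=> e; have -> : (fun t => \sum_(k < n.+1) c k * h k e t) =
    (fun t => \sum_(k < n) c k * h k e t + c n * h n e t).
  by apply/funext => t; rewrite big_ord_recr.
apply: L2_itvD; first exact: IH.
by apply: L2_itvZ; exact: h2.
Qed.

Lemma L2_innerC h g : L2_inner h g = L2_inner g h.
Proof. by apply: eq_bigr => e _; apply: eq_Rintegral => t _; rewrite mulrC. Qed.

Lemma L2_inner_ge0 h : 0 <= L2_inner h h.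
Proof.
by apply: sumr_ge0 => e _; apply: Rintegral_ge0 => t _; rewrite -expr2 sqr_ge0.
Qed.

Lemma L2_innerDl f g h : L2 f -> L2 g -> L2 h ->
  L2_inner (fun e t => f e t + g e t) h = L2_inner f h + L2_inner g h.
Proof.
move=> f2 g2 h2; rewrite -big_split; apply: eq_bigr => e _ /=.
have i1 := L2_itvM (f2 e) (h2 e); have i2 := L2_itvM (g2 e) (h2 e).
rewrite -RintegralD//.
by apply: eq_Rintegral => t _; rewrite mulrDl.
Qed.

Lemma L2_innerZl c f h : L2 f -> L2 h ->
  L2_inner (fun e t => c * f e t) h = c * L2_inner f h.
Proof.
move=> f2 h2; rewrite /L2_inner mulr_sumr; apply: eq_bigr => e _ /=.
have i1 := L2_itvM (f2 e) (h2 e); rewrite -RintegralZl//.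
by apply: eq_Rintegral => t _; rewrite mulrA.
Qed.

Lemma L2_inner_suml (c : nat -> R) (f : nat -> gedge G -> R -> R) h n :
  (forall k, L2 (f k)) -> L2 h ->
  L2_inner (fun e t => \sum_(k < n) c k * f k e t) h =
  \sum_(k < n) c k * L2_inner (f k) h.
Proof.
move=> f2 h2; elim: n => [|n IH].
  rewrite big_ord0 /L2_inner big1// => e _.
  under eq_Rintegral do rewrite big_ord0 mul0r.
  by rewrite Rintegral_cst// mul0r.
rewrite big_ord_recr/= -IH -L2_innerZl// -L2_innerDl//.
- apply: eq_bigr => e _; apply: eq_Rintegral => t _.
  by rewrite big_ord_recr.
- exact: L2_sum.
- exact: L2Z.
Qed.

Lemma L2_parseval (phi : nat -> gedge G -> R -> R) (al : nat -> R) f :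
  (forall k, L2 (phi k)) -> L2 f ->
  (forall j k, L2_inner (phi j) (phi k) = (j == k)%:R) ->
  (fun N => let r := fun e t => f e t - \sum_(k < N) al k * phi k e t in
     L2_inner r r) @ \oo --> 0 ->
  \sum_(k < N) al k ^+ 2 @[N --> \oo] --> L2_inner f f.
Proof.
move=> p2 f2 orth; set D := (fun N => _) => D0.
pose S N := fun e t => \sum_(k < N) al k * phi k e t.
have S2 N : L2 (S N) by exact: L2_sum.
pose r N := fun e t => f e t + -1 * S N e t.
have r2 N : L2 (r N) by apply: L2D => //; exact: L2Z.
have DE N : D N = L2_inner (r N) (r N).
  by apply: eq_bigr => e _; apply: eq_Rintegral => t _; rewrite /r mulN1r.
have Sphi N j : (j < N)%N -> L2_inner (S N) (phi j) = al j.
  move=> jN; rewrite L2_inner_suml// (bigD1 (Ordinal jN))//= orth eqxx mulr1.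
  rewrite big1 ?addr0// => k kj.
  rewrite orth (_ : _ == _ = false) ?mulr0//; apply: contraNF kj => /eqP kj.
  exact/eqP/val_inj.
have SS N : L2_inner (S N) (S N) = \sum_(k < N) al k ^+ 2.
  rewrite L2_inner_suml//; apply: eq_bigr => k _.
  by rewrite L2_innerC Sphi// expr2.
have Ms N : L2 (fun e t => -1 * S N e t) by exact: L2Z.
have rphi N j : (j < N)%N -> L2_inner (r N) (phi j) = L2_inner f (phi j) - al j.
  by move=> jN; rewrite L2_innerDl// L2_innerZl// Sphi// mulN1r.
have bessel h k : L2 h -> L2_inner h (phi k) ^+ 2 <= L2_inner h h.
  move=> h2; set c := L2_inner h (phi k).
  have z2 : L2 (fun e t => - c * phi k e t) by exact: L2Z.
  have := L2_inner_ge0 (fun e t => h e t + - c * phi k e t).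
  rewrite L2_innerDl//; last exact: L2D.
  rewrite L2_innerZl//; last exact: L2D.
  rewrite (L2_innerC h) (L2_innerC (phi k)) !L2_innerDl// !L2_innerZl//.
  by rewrite orth eqxx (L2_innerC (phi k)) -/c mulr1; lra.
(* Nothing says in advance that [al] consists of the Fourier coefficients of [f]. For N > j the
   difference of the two is the coefficient of [r N], which [bessel] bounds by a quantity tending to
   0. *)
have fal j : L2_inner f (phi j) = al j.
  apply/eqP; rewrite -subr_eq0 -sqrf_eq0; apply/eqP/le_anti; rewrite sqr_ge0 andbT.
  apply: (cvgr_to_ge D0).
  by exists j.+1 => // N /= jN; rewrite DE -(rphi N)// bessel.
have DS N : D N = L2_inner f f - \sum_(k < N) al k ^+ 2.
  have fS : L2_inner f (S N) = \sum_(k < N) al k ^+ 2.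
    rewrite L2_innerC L2_inner_suml//; apply: eq_bigr => k _.
    by rewrite L2_innerC fal expr2.
  rewrite DE L2_innerDl// L2_innerZl//.
  rewrite (L2_innerC f) (L2_innerC (S N)) !L2_innerDl// !L2_innerZl//.
  by rewrite (L2_innerC (S N) f) fS SS; ring.
have : (fun N => L2_inner f f - D N) @ \oo --> L2_inner f f - 0.
  by apply: cvgB => //; exact: cvg_cst.
rewrite subr0; apply: cvg_trans; apply: near_eq_cvg; apply: nearW => N /=.
by rewrite DS; ring.
Qed.

End L2Graph.

Section Regularity.
Context {R : realType} (G : metric_graph R) (kappa lam : R).
Hypothesis glen0 : forall e : gedge G, 0 < glen e.

(* Elliptic regularity: since [g = (kappa^2 - lam) f] almost everywhere, the
   second weak derivative has a continuous representative. *)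
Lemma eigenfunction_C2 (f : point G -> R) :
  whittle_op kappa f (fun e t => lam * restr f e t) ->
  graph_continuous f /\ exists f1 : gedge G -> R -> R,
  [/\ forall e, C1_on 0 (glen e) (restr f e) (f1 e),
      forall e, C1_on 0 (glen e) (f1 e) (fun t => (kappa ^+ 2 - lam) * restr f e t)
    & forall v, \sum_(e | gsrc e == v) f1 e 0
              - \sum_(e | gtgt e == v) f1 e (glen e) = 0].
Proof.
move=> [g [cf [f1 [sob kir]]] ae]; split => //; exists f1.
have h2 e : C1_on 0 (glen e) (f1 e) (fun t => (kappa ^+ 2 - lam) * restr f e t).
  have cz : {within `[0, glen e], continuous
      (fun t => (kappa ^+ 2 - lam) * restr f e t)} by exact: within_continuousZ.
  apply: C1_on_primitive => // t /andP[t0 tl].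
  have [_ [_ [mg _] f1E]] := sob e.
  rewrite f1E ?t0//; congr (_ + _); congr fine; apply: ae_eq_integral => //.
  - apply/measurable_EFinP; apply: measurable_funS mg => // x /=.
    by rewrite !in_itv/= => /andP[-> xt]; exact: le_trans tl.
  - apply: (measurable_int mu); apply: within_continuous_integrable.
    exact: (within_continuousS (lexx _) tl cz).
  - have [N [mN N0 NS]] := ae e; exists N; split => // x nx; apply: NS => hx.
    apply: nx => xt; congr _%:E.
    have : `[0, glen e]%classic x.
      by move: xt; rewrite /= !in_itv/= => /andP[-> xt]; exact: le_trans tl.
    by move=> /hx hx'; rewrite mulrBl hx'; ring.
split => //.
- move=> e; have [[_ _ fE] _] := sob e; have [cf1 _ _] := h2 e.
  exact: (C1_on_primitive (glen0 e) cf1 fE).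
- by move=> v; rewrite -[RHS](kir v) sumrN.
Qed.

End Regularity.

(** * The extended graph *)

Section Extended.
Context {R : realType} (G : metric_graph R) (n : nat) (s : 'I_n -> point G).
Hypothesis glen0 : forall e : gedge G, 0 < glen e.

Local Notation EG := (extended_graph s).
Local Notation bp := (breakpoint s).
Local Notation ncuts e := (size (cuts s e)).


Lemma cuts_bounds e x : x \in cuts s e -> 0 < x < glen e.
Proof.
rewrite mem_sort mem_undup mem_pmap => /mapP[y _].
case: y => [v|p] //=; case: eqP => // <- [->]; exact: (valP p).
Qed.

Lemma breakpoint0 e : bp e 0 = 0. Proof. by []. Qed.

Lemma breakpoint_last e : bp e (ncuts e).+1 = glen e.
Proof. by rewrite /breakpoint /= nth_rcons ltnn eqxx. Qed.

Lemma breakpoint_ltS e j : (j <= ncuts e)%N -> bp e j < bp e j.+1.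
Proof.
move=> jn; have : path <%R 0 (rcons (cuts s e) (glen e)).
  rewrite rcons_path lt_path_sortedE sort_lt_sorted undup_uniq andbT.
  apply/andP; split; first by apply/allP => x /cuts_bounds /andP[].
  have : last 0 (cuts s e) \in 0 :: cuts s e by exact: mem_last.
  by rewrite inE => /predU1P[->//|/cuts_bounds /andP[]].
by move=> /(pathP 0)/(_ j); rewrite size_rcons ltnS => /(_ jn).
Qed.

Lemma breakpoint_le e j k : (j <= k)%N -> (k <= (ncuts e).+1)%N -> bp e j <= bp e k.
Proof.
move=> jk kn; elim: k jk kn => [|k IH].
  by rewrite leqn0 => /eqP ->.
rewrite leq_eqVlt => /predU1P[->//|]; rewrite !ltnS => jk kn.
by apply: le_trans (IH jk (leqW kn)) _; exact: ltW (breakpoint_ltS kn).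
Qed.

Definition piece_edge (i : gedge EG) : gedge G := tag i.
Definition piece_lo (i : gedge EG) : R := bp (tag i) (tagged i).
Definition piece_hi (i : gedge EG) : R := bp (tag i) (tagged i).+1.

Lemma piece_lo_lt_hi i : piece_lo i < piece_hi i.
Proof. by apply: breakpoint_ltS; rewrite -ltnS ltn_ord. Qed.

Lemma piece_lo_ge0 i : 0 <= piece_lo i.
Proof. by rewrite -(breakpoint0 (tag i)) breakpoint_le// ltnW// ltnS ltnW. Qed.

Lemma piece_hi_le i : piece_hi i <= glen (piece_edge i).
Proof. by rewrite -breakpoint_last breakpoint_le// ltn_ord. Qed.

Lemma piece_itv_sub i t : piece_lo i <= t <= piece_hi i -> 0 <= t <= glen (piece_edge i).
Proof.
move=> /andP[h1 h2]; rewrite (le_trans (piece_lo_ge0 i) h1)/=.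
exact: le_trans (piece_hi_le i).
Qed.

Lemma sum_pieces (F : forall e, 'I_(ncuts e).+1 -> R) :
  \sum_(i : gedge EG) F (tag i) (tagged i) = \sum_e \sum_j F e j.
Proof. by rewrite sig_big_dep. Qed.

Lemma itg_breakpoints e h m : mu.-integrable `[0, glen e] (EFin \o h) ->
  (m <= (ncuts e).+1)%N ->
  itg 0 (bp e m) h = \sum_(j < m) itg (bp e j) (bp e j.+1) h.
Proof.
move=> ih; elim: m => [|m IH] mn.
  by rewrite big_ord0 /itg breakpoint0 set_itv1 Rintegral_set1.
have h1 : 0 <= bp e m by rewrite -(breakpoint0 e) breakpoint_le// ltnW.
have h2 : bp e m.+1 <= glen e by rewrite -breakpoint_last breakpoint_le.
rewrite big_ord_recr/= -IH ?(ltnW mn)//; apply: itg_split => //.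
  exact/ltW/breakpoint_ltS.
apply: integrableS ih => // x /=; rewrite !in_itv/= => /andP[->].
by move=> /le_trans -> .
Qed.

Lemma itg_edge_pieces (h : gedge G -> R -> R) :
  (forall e, mu.-integrable `[0, glen e] (EFin \o h e)) ->
  \sum_e itg 0 (glen e) (h e) = \sum_i itg (piece_lo i) (piece_hi i) (h (piece_edge i)).
Proof.
move=> ih.
rewrite (sum_pieces (fun e j => itg (bp e j) (bp e j.+1) (h e))).
by apply: eq_bigr => e _; rewrite -breakpoint_last itg_breakpoints// breakpoint_last.
Qed.

Definition piece e (j : 'I_(ncuts e).+1) : gedge EG :=
  Tagged (fun e => 'I_(ncuts e).+1) j.

(** Half-open intervals keep the pieces disjoint, so that no breakpoint is counted twice. At the end
    [glen e] of the edge the glued function is 0, which integrals do not see. *)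
Definition glue (F : gedge EG -> R -> R) : gedge G -> R -> R := fun e t =>
  \sum_(j < (ncuts e).+1)
    (F (piece j) \_ `[bp e j, bp e j.+1[) t.

Lemma glueE F i t : piece_lo i <= t < piece_hi i -> glue F (piece_edge i) t = F i t.
Proof.
case: i => e j; rewrite /piece_lo /piece_hi /piece_edge/= => /andP[jt tj].
rewrite /glue (bigD1 j)//= patchE mem_set; last by rewrite /= in_itv/= jt.
rewrite big1 ?addr0// => k kj; rewrite patchE memNset//= in_itv/=.
move=> /andP[kt tk]; move: kj; rewrite neq_ltn => /orP[kj|jk].
  have := breakpoint_le kj (ltnW (ltn_ord j)).
  by rewrite leNgt (le_lt_trans jt).
have := breakpoint_le jk (ltnW (ltn_ord k)).
by rewrite leNgt (le_lt_trans kt).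
Qed.

Lemma L2_glue F : pcont piece_lo piece_hi F -> L2 (glue F).
Proof.
move=> cF e.
have bF (j : 'I_(ncuts e).+1) : {M | 0 <= M & forall t, bp e j <= t <= bp e j.+1 ->
    `|F (piece j) t| <= M}.
  apply/cid2/within_continuous_bounded; last exact: (cF (piece j)).
  exact: ltW (piece_lo_lt_hi (piece j)).
apply: (@bounded_L2_itv _ _ _ (\sum_j s2val (bF j))).
  apply: (@measurable_sum _ _ _ `[0, glen e]) => j.
  apply: measurable_funTS.
  apply/(@measurable_restrictT _ _ _ _ `[bp e j, bp e j.+1[ (F (piece j))) => //.
  have /measurable_int/measurable_EFinP := within_continuous_integrable (cF (piece j)).
  move=> mF; apply: measurable_funS mF => // x /=.
  by rewrite !in_itv/= => /andP[-> /ltW].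
move=> t _; apply: le_trans (ler_norm_sum _ _ _) _; apply: ler_sum => j _.
rewrite patchE; case: ifPn => [|_].
  rewrite inE/= in_itv/= => /andP[jt /ltW tj].
  by apply: (s2valP' (bF j)); rewrite jt.
by rewrite normr0; exact: (s2valP (bF j)).
Qed.

Lemma L2_inner_glue H F :
  (forall e, {within `[0, glen e], continuous (H e)}) -> pcont piece_lo piece_hi F ->
  L2_inner H (glue F) = ip piece_lo piece_hi (fun i => H (piece_edge i)) F.
Proof.
move=> cH cF; have gF := L2_glue cF.
have ih e : mu.-integrable `[0, glen e] (EFin \o (fun t => H e t * glue F e t)).
  apply: L2_itvM; last exact: gF.
  by apply: continuous_L2_itv => //; exact: ltW.
rewrite /L2_inner -/(itg 0 _ _) [LHS](itg_edge_pieces ih).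
apply: eq_bigr => i _; rewrite /itg -!Rintegral_itv_bndo_bndc.
- apply: eq_Rintegral => t; rewrite inE/= in_itv/= => ti.
  by rewrite glueE.
- apply: integrableS (within_continuous_integrable (within_continuousM _ (cF i))) => //.
    by move=> x /=; rewrite !in_itv/= => /andP[-> /ltW].
  apply: (within_continuousS _ _ (cH (piece_edge i))); first exact: piece_lo_ge0.
  exact: piece_hi_le.
- apply: integrableS (ih _) => // x /=; rewrite !in_itv/= => /andP[xl xh].
  by apply: (@piece_itv_sub i); rewrite xl ltW.
Qed.

Lemma pt_src e : pt e 0 = inl (gsrc e) :> point G.
Proof.
rewrite /pt; case: insubP => [p|_]; first by rewrite /= ltxx.
by rewrite lexx.
Qed.

Lemma pt_tgt e : pt e (glen e) = inl (gtgt e) :> point G.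
Proof.
rewrite /pt; case: insubP => [p|_]; first by rewrite /= ltxx andbF.
by rewrite leNgt glen0.
Qed.

(* The contributions of the two sides of each interior breakpoint cancel. *)
Lemma kirchhoff_pieces (f1 : gedge G -> R -> R) :
  (forall v, \sum_(e | gsrc e == v) f1 e 0 -
             \sum_(e | gtgt e == v) f1 e (glen e) = 0) ->
  forall v : gvert EG, \sum_(i | gsrc i == v) f1 (piece_edge i) (piece_lo i) -
             \sum_(i | gtgt i == v) f1 (piece_edge i) (piece_hi i) = 0.
Proof.
move=> kir v; pose A e j := if ext_vertex s e j == v then f1 e (bp e j) else 0.
rewrite big_mkcond [X in _ - X]big_mkcond/= -sumrB.
rewrite (sum_pieces (fun e j => A e j - A e j.+1)).
have -> : \sum_e \sum_(j < (ncuts e).+1) (A e j - A e j.+1) =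
    \sum_e (A e 0%N - A e (ncuts e).+1).
  apply: eq_bigr => e _.
  rewrite -(big_mkord xpredT (fun j => A e j - A e j.+1)).
  by rewrite -[LHS]opprK -sumrN; under eq_bigr do rewrite opprB;
    rewrite telescope_sumr// opprB.
have vE e j : (ext_vertex s e j == v) = (pt e (bp e j) == ssval v).
  by rewrite -val_eqE.
rewrite /A; under eq_bigr do rewrite !vE breakpoint0 breakpoint_last pt_src pt_tgt.
case: (ssval v) => [v0|p]; last by rewrite big1// => e _; rewrite subrr.
have := kir v0; rewrite big_mkcond [X in _ - X]big_mkcond/= -sumrB.
exact: etrans.
Qed.

Lemma dom_of_C2 (f : point G -> R) (f1 f2 : gedge G -> R -> R) :
  (forall e, C1_on 0 (glen e) (restr f e) (f1 e)) ->
  (forall e, C1_on 0 (glen e) (f1 e) (f2 e)) ->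
  (forall v, \sum_(e | gsrc e == v) f1 e 0 -
             \sum_(e | gtgt e == v) f1 e (glen e) = 0) ->
  dom piece_lo piece_hi (@gsrc _ EG) (@gtgt _ EG)
    (fun i => restr f (piece_edge i)) (fun i => f1 (piece_edge i))
    (fun i => f2 (piece_edge i)).
Proof.
move=> h1 h2 kir; split.
- by move=> i; apply: C1_onS (h1 _); [exact: piece_lo_ge0|exact: piece_hi_le].
- by move=> i; apply: C1_onS (h2 _); [exact: piece_lo_ge0|exact: piece_hi_le].
- by exists (fun v => f (ext_point v)).
- exact: kirchhoff_pieces.
Qed.

End Extended.

(** * The norm of L^(-1/2) L g *)

Section PowerNorm.
Context {R : realType} (G : metric_graph R) (n : nat) (s : 'I_n -> point G).
Hypothesis glen0 : forall e : gedge G, 0 < glen e.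
Context (kappa : R).
Hypothesis kappa0 : 0 < kappa.

Local Notation EG := (extended_graph s).
Local Notation ipE := (ip (@piece_lo _ _ _ s) (@piece_hi _ _ _ s)).
Local Notation domE :=
  (dom (@piece_lo _ _ _ s) (@piece_hi _ _ _ s) (@gsrc _ EG) (@gtgt _ EG)).
Local Notation pcontE := (pcont (@piece_lo _ _ _ s) (@piece_hi _ _ _ s)).

Lemma L2_inner_pieces (H K : gedge G -> R -> R) :
  (forall e, {within `[0, glen e], continuous (H e)}) ->
  (forall e, {within `[0, glen e], continuous (K e)}) ->
  L2_inner H K = ipE (fun i => H (piece_edge i)) (fun i => K (piece_edge i)).
Proof.
move=> cH cK; rewrite /L2_inner -/(itg 0 _ _).
apply: (itg_edge_pieces s glen0 (h := fun e t => H e t * K e t)) => e.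
by apply: L2_itvM; apply: continuous_L2_itv => //; exact: ltW.
Qed.

(** Translates the conclusion of completeness, an equality almost everywhere on the edges, into the
    form assumed by [energy_parseval]. *)
Lemma ip_glue_eq0 r h : pcontE r -> pcontE h ->
  L2_eq (glue r) (fun _ _ => 0) -> ipE r h = 0.
Proof.
move=> cr ch r0; apply: big1 => i _.
have irh := within_continuous_integrable (within_continuousM (@cr i) (@ch i)).
have irh' : mu.-integrable `[piece_lo i, piece_hi i[ (EFin \o (fun t => r i t * h i t)).
  by apply: integrableS irh => // x /=; rewrite !in_itv/= => /andP[-> /ltW].
rewrite /itg -Rintegral_itv_bndo_bndc// /Rintegral.
rewrite (@ae_eq_integral _ _ _ mu _ (cst 0%E)) ?integral_cst ?mul0e//.
  exact: measurable_int irh'.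
have [N [mN N0 NS]] := r0 (piece_edge i); exists N; split => // x nx; apply: NS => hx.
apply: nx => xi; rewrite /= in xi *.
have /andP[xl xh] : piece_lo i <= x < piece_hi i by rewrite in_itv in xi.
rewrite -glueE ?xl// hx ?mul0r//= in_itv/=.
by apply: piece_itv_sub => //; rewrite xl ltW.
Qed.

Lemma powR_Nhalf_sqr (x : R) : 0 < x -> (x `^ (- 2^-1)) ^+ 2 = x^-1.
Proof.
move=> x0; rewrite powRN powR12_sqrt ?(ltW x0)// exprVn sqr_sqrtr//; exact: ltW.
Qed.

(** Whichever eigenbasis represents the power, Parseval makes the left side the sum of lam_k^-1 (L
    g, psi_k)^2. Since (L g, psi_k) = lam_k (g, psi_k), this is the series summed by
    [energy_parseval], and the value is independent of the basis. *)
Lemma whittle_pow_norm g g1 g2 f : domE g g1 g2 ->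
  whittle_pow kappa (- 2^-1) (glue (Lop kappa g g2)) f ->
  L2_inner f f = ipE (Lop kappa g g2) g.
Proof.
move=> dg [lam [psi [[eigen orth comp] f2]]] D0.
have reg k := eigenfunction_C2 glen0 (eigen k).
have cpsi k e : {within `[0, glen e], continuous (restr (psi k) e)}.
  by case: (reg k).
have [psi1 hpsi1] := choice (fun k => (reg k).2).
have cLg := pcont_Lop (kappa := kappa) dg.
have [cg _ _] := dom_pcont dg.
pose F k := fun i : gedge EG => restr (psi k) (piece_edge i).
have dF k : domE (F k) (fun i => psi1 k (piece_edge i))
    (fun i t => (kappa ^+ 2 - lam k) * restr (psi k) (piece_edge i) t).
  by have [h1 h2 h3] := hpsi1 k; exact: (dom_of_C2 s glen0 h1 h2 h3).
have cF k : pcontE (F k) by have [] := dom_pcont (dF k).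
have orthF j k : ipE (F j) (F k) = (j == k)%:R.
  by rewrite -orth L2_inner_pieces//; exact: cpsi.
have compF r : pcontE r -> (forall k, ipE r (F k) = 0) ->
    forall h, pcontE h -> ipE r h = 0.
  move=> cr rF h ch; apply: ip_glue_eq0 => //.
  apply: comp; first exact: L2_glue.
  move=> k; rewrite L2_innerC L2_inner_glue//.
  by rewrite ipC rF.
have psi2 k : L2 (restr (psi k)).
  by move=> e; apply: continuous_L2_itv; [exact: ltW|exact: cpsi].
pose al k := lam k `^ (- 2^-1) * L2_inner (glue (Lop kappa g g2)) (restr (psi k)).
have := L2_parseval (al := al) psi2 f2 orth D0 => h1.
have eigF k i t : piece_lo i <= t <= piece_hi i ->
    (kappa ^+ 2 - lam k) * restr (psi k) (piece_edge i) t =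
    (kappa ^+ 2 - lam k) * F k i t by [].
have ab := @piece_lo_lt_hi _ _ _ s glen0.
have h2 := energy_parseval ab kappa0 dF eigF orthF compF dg.
suff E : (fun N => \sum_(k < N) al k ^+ 2) =
    (fun N => \sum_(k < N) lam k * ipE g (F k) ^+ 2).
  by rewrite E in h1; exact: (cvg_unique _ h1 h2).
apply/funext => N; apply: eq_bigr => k _.
rewrite /al L2_innerC L2_inner_glue//.
rewrite ipC (ip_Lop_eigen ab dF eigF k dg) -/(F k).
have l0 := eigenvalue_gt0 ab kappa0 dF eigF orthF k.
rewrite exprMn powR_Nhalf_sqr// exprMn expr2 !mulrA mulVf ?mul1r// gt_eqF//.
Qed.

End PowerNorm.

(** * Gaussian variables *)

Section NormalMoment.
Context {R : realType}.

(** The change of variables is available for the Radon-Nikodym derivative; it agrees almost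
    everywhere with the density because both have the same integral over every measurable set. *)
Lemma ge0_integral_normal_prob (m sg : R) (f : R -> \bar R) :
  measurable_fun setT f -> (forall x, 0 <= f x)%E ->
  (\int[normal_prob m sg]_x f x = \int[mu]_x (f x * (normal_pdf m sg x)%:E))%E.
Proof.
move=> mf f0; have dm := @normal_prob_dominates R m sg.
rewrite -(Radon_Nikodym_SigmaFinite.change_of_variables dm)//.
apply: ae_eq_integral => //.
- apply: emeasurable_funM => //; apply: (measurable_int mu).
  exact: Radon_Nikodym_SigmaFinite.f_integrable.
- apply: emeasurable_funM => //; apply/measurable_EFinP.
  exact: measurable_normal_pdf.
- apply: ae_eqe_mul2l; apply: integral_ae_eq => //.
  + exact: Radon_Nikodym_SigmaFinite.f_integrable.
  + by apply/measurable_EFinP; exact: measurable_normal_pdf.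
  + by move=> E _ mE; rewrite -Radon_Nikodym_SigmaFinite.f_integral.
Qed.

Section moment.
Context (sg : R).
Hypothesis sg0 : 0 < sg.

Let p := normal_pdf 0 sg.
Let p_ge0 x : 0 <= p x. Proof. exact: normal_pdf_ge0. Qed.
Let cp : continuous p. Proof. by apply: continuous_normal_pdf; rewrite gt_eqF. Qed.

Let pE x : p x = normal_peak sg * expR (- (2 * sg ^+ 2)^-1 * x ^+ 2).
Proof.
rewrite /p normal_pdfE ?gt_eqF// /normal_fun subr0; congr (_ * expR _).
by rewrite -mulr_natl mulNr mulrC mulNr.
Qed.

(** [F] is a primitive of [f], and x^2 p = f + sg^2 p; this reduces the second moment to the total
    mass of the density. *)
Let F (x : R) : R := - (sg ^+ 2 * (x * p x)).
Let f (x : R) : R := (x ^+ 2 - sg ^+ 2) * p x.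

Let dp (x : R) : is_derive x 1 p (- (sg ^- 2 * x) * p x).
Proof.
have -> : p = fun x => normal_peak sg *: expR (- (2 * sg ^+ 2)^-1 * x ^+ 2).
  by apply/funext => y; rewrite pE.
pose e (x : R) := - (2 * sg ^+ 2)^-1 * x ^+ 2.
have h1 : is_derive x 1 e (- (2 * sg ^+ 2)^-1 * (2 * x)).
  have -> : e =
      (fun x => (- (2 * sg ^+ 2)^-1) *: (x * x)) by apply/funext => y; rewrite /e expr2.
  by apply: is_derive_eq; rewrite /GRing.scale/= !mulr1; ring.
have h2 := is_derive1_comp (is_derive_expR (e x)) h1.
have [d1 d2] := is_deriveZ (normal_peak sg) h2.
apply: DeriveDef; first exact: d1.
apply: etrans d2 _; rewrite /GRing.scale/= /e.
have s0 : sg != 0 by rewrite gt_eqF.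
by field.
Qed.

Let dF (x : R) : is_derive x 1 F (f x).
Proof.
have -> : F = fun x => (- sg ^+ 2) *: (x * p x).
  by apply/funext => y; rewrite /F /GRing.scale/= mulNr.
have h := dp x.
apply: is_derive_eq; rewrite /f /GRing.scale/= ?mulr1.
have s0 : sg != 0 by rewrite gt_eqF.
by field.
Qed.

Let cF : continuous F.
Proof. by move=> x; apply/differentiable_continuous/derivable1_diffP; case: (dF x). Qed.

Let cf : continuous f.
Proof.
move=> x; apply: cvgM; last exact: cp.
by apply: cvgB; [exact: exprn_continuous|exact: cvg_cst].
Qed.

Let cvgF : F x @[x --> +oo] --> 0.
Proof.
rewrite -oppr0; apply: cvgN.
pose K := sg ^+ 2 * (normal_peak sg * (2 * sg ^+ 2)).
apply: (@squeeze_cvgr _ _ _ _ (fun=> 0) (fun x => K * x^-1)).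
- near=> x.
  have x0 : 0 < x by near: x; exact: nbhs_pinfty_gt.
  have -> /= : 0 <= sg ^+ 2 * (x * p x).
    by apply: mulr_ge0; [exact: sqr_ge0|apply: mulr_ge0; [exact: ltW|exact: p_ge0]].
  rewrite /K -mulrA ler_wpM2l ?sqr_ge0// pE mulrCA -mulrA ler_wpM2l ?normal_peak_ge0//.
  rewrite ler_pdivlMr// mulrAC -expr2 mulNr expRN.
  rewrite ler_pdivrMr ?expR_gt0//.
  have s2 : 0 < 2 * sg ^+ 2 by rewrite mulr_gt0// exprn_gt0.
  apply: le_trans (_ : 2 * sg ^+ 2 * (1 + (2 * sg ^+ 2)^-1 * x ^+ 2) <= _); last first.
    by rewrite ler_pM2l// expR_ge1Dx.
  have s0 : sg != 0 by rewrite gt_eqF.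
  have -> : 2 * sg ^+ 2 * (1 + (2 * sg ^+ 2)^-1 * x ^+ 2) = 2 * sg ^+ 2 + x ^+ 2 by field.
  by rewrite lerDr ltW.
- exact: cvg_cst.
- rewrite -[X in _ --> X](mulr0 K); apply: cvgMl_tmp.
  apply/gtr0_cvgV0; first by near=> x; near: x; exact: nbhs_pinfty_gt.
  exact: cvg_id.
Unshelve. all: by end_near. Qed.

(** The cut is at [sg] because [f] changes sign there: the fundamental theorem on an unbounded
    interval is applied to a nonnegative integrand, and [0, sg] is left to the compact case. *)
Let nonneg_split (h : R -> R) : (forall x, 0 <= h x) -> continuous h ->
  (\int[mu]_(x in [set x : R | (0 <= x)%R]) (h x)%:E =
   (itg 0 sg h)%:E + \int[mu]_(x in `[sg, +oo[) (h x)%:E)%E.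
Proof.
move=> h0 ch; have mh : measurable_fun setT h by exact: continuous_measurable_fun.
have -> : [set x : R | 0 <= x] = `[0, sg[%classic `|` `[sg, +oo[%classic.
  apply/seteqP; split => x /=; rewrite !in_itv/= ?andbT.
    by move=> x0; case: (ltP x sg) => xs; [left; rewrite x0|right].
  by move=> [/andP[]//|]; exact: le_trans (ltW sg0).
rewrite ge0_integral_setU//=.
- congr (_ + _)%E; rewrite integral_itv_bndo_bndc; last first.
    exact/measurable_EFinP/measurable_funTS.
  rewrite /itg /Rintegral fineK// integrable_fin_num//.
  apply: within_continuous_integrable; exact: continuous_subspaceT.
- by apply/measurable_EFinP; exact: measurable_funTS.
- by move=> x _; rewrite lee_fin.
- apply/disj_setPS => x [/=]; rewrite !in_itv/= andbT => /andP[_ h1] h2.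
  by move: h1; rewrite ltNge h2.
Qed.

Lemma integral_sqr_normal_prob : (\int[normal_prob 0 sg]_x (x ^+ 2)%:E = (sg ^+ 2)%:E)%E.
Proof.
have cx2 : continuous (fun x : R => x ^+ 2) by exact: exprn_continuous.
have mx2 : measurable_fun setT (fun x : R => x ^+ 2).
  exact: continuous_measurable_fun.
have mp : measurable_fun setT p by exact: measurable_normal_pdf.
rewrite ge0_integral_normal_prob; first last.
- by move=> x; rewrite lee_fin sqr_ge0.
- exact/measurable_EFinP.
under eq_integral do rewrite -EFinM.
pose h x := x ^+ 2 * p x.
have ch : continuous h by move=> x; apply: cvgM; [exact: cx2|exact: cp].
have h0 x : 0 <= h x by rewrite mulr_ge0// sqr_ge0.
have evp x : p (- x) = p x by rewrite !pE sqrrN.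
have := @ge0_symfun_integralT R h h0 ch; rewrite /h => ->; last first.
  by move=> x /=; rewrite /h sqrrN evp.
have := @ge0_symfun_integralT R p p_ge0 cp (fun x => esym (evp x)).
rewrite integral_normal_pdf (nonneg_split p_ge0 cp) (nonneg_split h0 ch).
have ip : mu.-integrable `[sg, +oo[ (EFin \o p).
  by apply: integrableS (@integrable_normal_pdf R 0 sg).
have : (\int[mu]_(x in `[sg, +oo[) (p x)%:E \is a fin_num)%E.
  exact: integrable_fin_num.
case E : (\int[mu]_(x in `[sg, +oo[) (p x)%:E)%E => [pb| |]// _.
have -> : (\int[mu]_(x in `[sg, +oo[) (h x)%:E = (- F sg + sg ^+ 2 * pb)%:E)%E.
  have fy : (\int[mu]_(x in `[sg, +oo[) (f x)%:E = (- F sg)%:E)%E.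
    rewrite (@ge0_continuous_FTC2y _ f F sg 0) ?sub0e//.
    - move=> x sx; rewrite mulr_ge0// subr_ge0 lerXn2r// nnegrE ?(ltW sg0)//.
      by rewrite (le_trans (ltW sg0)).
    - exact: continuous_subspaceT.
    - by move=> x _; case: (dF x).
    - apply: cvg_at_right_filter; exact: cF.
    - by move=> x _; rewrite derive1E; have [_ ->] := dF x.
  rewrite EFinD -fy EFinM -E -ge0_integralZl//; first last.
  - by rewrite lee_fin sqr_ge0.
  - by move=> x _; rewrite lee_fin.
  - by apply/measurable_EFinP; exact: measurable_funTS.
  rewrite -ge0_integralD//.
  - by apply: eq_integral => x _; rewrite -EFinM -EFinD; congr _%:E; rewrite /h /f; ring.
  - move=> x /=; rewrite in_itv/= andbT => sx; rewrite lee_fin mulr_ge0//.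
    by rewrite subr_ge0 lerXn2r// nnegrE ?(ltW sg0)// (le_trans (ltW sg0)).
  - apply/measurable_EFinP/measurable_funTS; exact: continuous_measurable_fun.
  - by move=> x _; rewrite -EFinM lee_fin mulr_ge0// sqr_ge0.
  - apply/measurable_EFinP/measurable_funTS; apply: measurable_funM => //.
have -> : itg 0 sg h = F sg + sg ^+ 2 * itg 0 sg p.
  have F0 : F 0 = 0 by rewrite /F mul0r mulr0 oppr0.
  have dFi : C1_on 0 sg F f by exact: C1_on_derive.
  have wf : {within `[0, sg], continuous f} by exact: continuous_subspaceT.
  have wp : {within `[0, sg], continuous p} by exact: continuous_subspaceT.
  have wz := within_continuousZ (c := sg ^+ 2) wp.
  have := itg_C1 sg0 dFi; rewrite F0 subr0 => <-.
  rewrite -itgZ// -itgD//.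
  by apply: eq_itg => x _; rewrite /h /f; ring.
(* The boundary terms [F sg] of the two intervals cancel, and [e1] says that twice the mass of the
   half line is 1. *)
rewrite -!EFinD -!EFinM => -[e1]; congr _%:E.
by transitivity (sg ^+ 2 * (2 * (itg 0 sg p + pb))); [ring|rewrite -e1 mulr1].
Qed.

End moment.

Lemma integral_sqr_normal_law (v : R) : 0 <= v ->
  forall d (T : measurableType d) (P : probability T R) (X : T -> R),
  gaussian P X 0 v -> (\int[P]_x ((X x) ^+ 2)%:E = v%:E)%E.
Proof.
move=> v0 d T P X [mX _ law].
have mx2 : measurable_fun setT (fun x : R => (x ^+ 2)%:E).
  by apply/measurable_EFinP; apply: continuous_measurable_fun; exact: exprn_continuous.
have -> : (\int[P]_x ((X x) ^+ 2)%:E =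
    \int[pushforward P (X : T -> measurableTypeR R)]_x (x ^+ 2)%:E)%E.
  rewrite ge0_integral_pushforward//.
  by move=> x _; rewrite lee_fin sqr_ge0.
have [v00|vn0] := eqVneq v 0.
  rewrite (@eq_measure_integral _ _ _ _ (\d_(0%R : measurableTypeR R))%E).
    by rewrite integral_dirac// diracT mul1e expr0n v00.
  by move=> A mA _; have := law A mA; rewrite /normal_law v00 eqxx.
have sv : 0 < Num.sqrt v by rewrite sqrtr_gt0 lt0r vn0.
rewrite (@eq_measure_integral _ _ _ _ (normal_prob 0 (Num.sqrt v))).
  by rewrite integral_sqr_normal_prob// sqr_sqrtr.
by move=> A mA _; have := law A mA; rewrite /normal_law (negbTE vn0).
Qed.

End NormalMoment.

(** * Second moments of almost sure limits *)

Section MeanSquareLimit.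
Context {R : realType} (d : measure_display) (T : measurableType d)
  (P : probability T R).
Implicit Types (X Y Z : T -> R).

Lemma limn_einf_le (u : nat -> \bar R) (K : \bar R) :
  (forall n, (u n <= K)%E) -> (limn_einf u <= K)%E.
Proof.
move=> uK; rewrite limn_einf_lim; apply: lime_le; first exact: is_cvg_einfs.
apply: nearW => n; apply: le_trans (uK n); apply: ereal_inf_lbound.
by exists n => //=.
Qed.

Let msq X : measurable_fun setT X -> measurable_fun setT (fun x => ((X x) ^+ 2)%:E).
Proof. by move=> mX; apply/measurable_EFinP; exact: measurable_funX. Qed.

(** A substitute for the triangle inequality in L^2: second moments are compared up to a factor 1 +
    dl, and [dl] is sent to 0 at the end. *)
Let sqrD_weighted (dl x y : R) : 0 < dl ->
  (x + y) ^+ 2 <= (1 + dl) * x ^+ 2 + (1 + dl^-1) * y ^+ 2.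
Proof.
move=> dl0; rewrite -subr_ge0.
have -> : (1 + dl) * x ^+ 2 + (1 + dl^-1) * y ^+ 2 - (x + y) ^+ 2 =
    dl^-1 * (dl * x - y) ^+ 2 by field; rewrite gt_eqF.
by rewrite mulr_ge0 ?sqr_ge0// invr_ge0 ltW.
Qed.

Let integral_sqrD (dl : R) X Y : 0 < dl ->
  measurable_fun setT X -> measurable_fun setT Y ->
  (\int[P]_x ((X x + Y x) ^+ 2)%:E <=
   (1 + dl)%:E * \int[P]_x ((X x) ^+ 2)%:E +
   (1 + dl^-1)%:E * \int[P]_x ((Y x) ^+ 2)%:E)%E.
Proof.
move=> dl0 mX mY; have i0 : 0 < dl^-1 by rewrite invr_gt0.
have c1 : (0 <= (1 + dl)%:E)%E by rewrite lee_fin addr_ge0// ltW.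
have c2 : (0 <= (1 + dl^-1)%:E)%E by rewrite lee_fin addr_ge0// ltW.
have sq Z x : (0 <= ((Z x) ^+ 2)%:E :> \bar R)%E by rewrite lee_fin sqr_ge0.
rewrite -!ge0_integralZl//; try exact: msq.
rewrite -ge0_integralD//; first last.
- by apply: measurable_funeM; exact: msq.
- by move=> x _; rewrite mule_ge0.
- by apply: measurable_funeM; exact: msq.
- by move=> x _; rewrite mule_ge0.
apply: ge0_le_integral => //.
- by move=> x _; exact: (sq (fun x => X x + Y x)).
- by apply: (msq (X := fun x => X x + Y x)); exact: measurable_funD.
- by apply: emeasurable_funD; apply: measurable_funeM; exact: msq.
- by move=> x _; rewrite -!EFinM -EFinD lee_fin sqrD_weighted.
Qed.

Let le_of_weighted (x v : R) : 0 <= v ->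
  (forall dl, 0 < dl -> x <= (1 + dl) * v) -> x <= v.
Proof.
move=> v0 h; apply/ler_addgt0Pr => e e0.
have v1 : 0 < v + 1 by rewrite ltr_wpDl.
have := h _ (divr_gt0 e0 v1); rewrite mulrDl mul1r => /le_trans; apply.
rewrite lerD2l mulrAC ler_pdivrMr// ler_pM2l//; lra.
Qed.

(** Fatou's lemma in m, applied to (Z_m - Z_n)^2, bounds the second moment of X - Z_n. The weighted
    inequality for X = Z_n + (X - Z_n) and for Z_n = X - (X - Z_n) then bounds that of X from both
    sides, with n going to infinity before [dl] goes to 0. *)
Lemma mean_square_limit X (Z : nat -> T -> R) (v : nat -> R) (vl C : R) :
  measurable_fun setT X -> (forall n, measurable_fun setT (Z n)) ->
  {ae P, forall om, Z n om @[n --> \oo] --> X om} ->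
  (forall n, (\int[P]_om ((Z n om) ^+ 2)%:E = (v n)%:E)%E) ->
  v n @[n --> \oo] --> vl ->
  (forall n m, (\int[P]_om ((Z n om + - Z m om) ^+ 2)%:E <=
     (C * (n.+1%:R^-1 + m.+1%:R^-1))%:E)%E) ->
  (\int[P]_om ((X om) ^+ 2)%:E = vl%:E)%E.
Proof.
move=> mX mZ ZX EZ vvl cau.
have C0 : 0 <= C.
  have : (0 <= (C * (1%:R^-1 + 1%:R^-1))%:E)%E.
    by apply: le_trans (cau 0%N 0%N); apply: integral_ge0 => x _; rewrite lee_fin sqr_ge0.
  by rewrite lee_fin; lra.
pose D n om := X om + - Z n om.
have mD n : measurable_fun setT (D n) by exact: measurable_funB.
pose ep n : R := C * 2 * n.+1%:R^-1.
have ED n : (\int[P]_om ((D n om) ^+ 2)%:E <= (ep n)%:E)%E.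
  (* Shifting the index by [n] makes the bound of [cau] at most 2 C / (n + 1) for every m, so it
     passes to the lower limit without discarding terms. *)
  pose g m om := ((Z (m + n)%N om + - Z n om) ^+ 2)%:E.
  have mg m : measurable_fun setT (g m).
    by apply: (msq (X := fun om => Z (m + n)%N om + - Z n om)); exact: measurable_funB.
  have g0 m om : setT om -> (0 <= g m om)%E by rewrite lee_fin sqr_ge0.
  have h : (limn_einf (fun m => \int[P]_om g m om) <= (ep n)%:E)%E.
    apply: limn_einf_le => m; apply: le_trans (cau _ _) _.
    rewrite lee_fin /ep -mulrA ler_wpM2l//.
    rewrite mulr_natl mulr2n lerD2r lef_pV2 ?posrE//.
    by rewrite ler_nat ltnS leq_addl.
  apply: le_trans h; apply: le_trans (fatou P measurableT mg g0).
  rewrite le_eqVlt; apply/orP; left; apply/eqP; apply: ge0_ae_eq_integral => //.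
  - exact: (msq (mD n)).
  - rewrite (_ : (fun x => _) = (fun x => - limn_esup (fun m => - g m x))%E).
      apply: measurableT_comp => //; apply: measurable_fun_limn_esup => m.
      exact: measurableT_comp.
    apply/funext => x; rewrite -limn_einfN; congr limn_einf.
    by apply/funext => m; rewrite [RHS](@oppeK R (g m x)).
  - by move=> x _; rewrite lee_fin sqr_ge0.
  - move=> x _; rewrite limn_einf_lim; apply: lime_ge; first exact: is_cvg_einfs.
    by apply: nearW => m; apply: le_ereal_inf_tmp => _ [k _ <-]; exact: g0.
  - have [N [mN N0 NS]] := ZX; exists N; split => // x nx; apply: NS => hx.
    apply: nx => _.
    have cg : g m x @[m --> \oo] --> ((D n x) ^+ 2)%:E.
      apply: cvg_EFin; first exact: nearW.
      have cZ : Z (m + n)%N x @[m --> \oo] --> X x.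
        by rewrite (cvg_shiftn n (fun m => Z m x)).
      have cD : Z (m + n)%N x + - Z n x @[m --> \oo] --> D n x.
        by apply: cvgB => //; exact: cvg_cst.
      exact: (cvgM cD cD).
    rewrite is_cvg_limn_einfE; last by apply/cvg_ex; eexists; exact: cg.
    by apply/esym/cvg_lim.
have ep0 : ep n @[n --> \oo] --> 0.
  by rewrite -[X in _ --> X](mulr0 (C * 2)); apply: cvgMl_tmp; exact: cvg_harmonic.
have vl0 : 0 <= vl.
  apply: (cvgr_to_ge vvl); apply: nearW => n.
  by rewrite -lee_fin -EZ; apply: integral_ge0 => x _; rewrite lee_fin sqr_ge0.
have lim1 dl (w : R) : w + (1 + dl^-1) * ep n @[n --> \oo] --> w.
  rewrite -[X in _ --> X](addr0 w) -(mulr0 (1 + dl^-1)).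
  by apply: cvgD; [exact: cvg_cst|exact: cvgMl_tmp].
have up dl n : 0 < dl -> (\int[P]_om ((X om) ^+ 2)%:E <=
    ((1 + dl) * v n + (1 + dl^-1) * ep n)%:E)%E.
  move=> dl0; have i0 : 0 < dl^-1 by rewrite invr_gt0.
  rewrite EFinD !EFinM -(EZ n).
  apply: (@le_trans _ _ (\int[P]_om ((Z n om + D n om) ^+ 2)%:E)%E).
    rewrite le_eqVlt; apply/orP; left; apply/eqP; apply: eq_integral => x _.
    by rewrite /D addrC subrK.
  apply: le_trans (integral_sqrD dl0 (mZ n) (mD n)) _.
  rewrite leeD2l// lee_wpmul2l// lee_fin addr_ge0// ltW//.
have X0 : (0 <= \int[P]_om ((X om) ^+ 2)%:E)%E.
  by apply: integral_ge0 => x _; rewrite lee_fin sqr_ge0.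
case E : (\int[P]_om ((X om) ^+ 2)%:E)%E X0 => [x| |] X0; last 2 first.
- by have := up 1 0%N ltr01; rewrite E leye_eq.
- by [].
rewrite lee_fin in X0.
congr _%:E; apply/le_anti/andP; split.
  apply: le_of_weighted => // dl dl0.
  have h : (1 + dl) * v n + (1 + dl^-1) * ep n @[n --> \oo] --> (1 + dl) * vl.
    rewrite -[X in _ --> X]addr0 -(mulr0 (1 + dl^-1)).
    by apply: cvgD; exact: cvgMl_tmp.
  apply: (cvgr_to_ge h); apply: nearW => n.
  by have := up dl n dl0; rewrite E lee_fin.
apply: le_of_weighted => // dl dl0.
have i0 : 0 < dl^-1 by rewrite invr_gt0.
have h : (1 + dl) * x + (1 + dl^-1) * ep n - v n @[n --> \oo] --> (1 + dl) * x - vl.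
  by apply: cvgB => //; exact: lim1.
rewrite -subr_ge0; apply: (cvgr_to_ge h); apply: nearW => n.
rewrite subr_ge0 -lee_fin -EZ EFinD !EFinM -E.
pose D' om := - D n om.
have mD' : measurable_fun setT D' by exact: measurableT_comp.
apply: (@le_trans _ _ (\int[P]_om ((X om + D' om) ^+ 2)%:E)%E).
  rewrite le_eqVlt; apply/orP; left; apply/eqP; apply: eq_integral => y _.
  by rewrite /D' /D opprD opprK addrA subrr add0r.
apply: le_trans (integral_sqrD dl0 mX mD') _.
rewrite leeD2l// lee_wpmul2l//; first by rewrite lee_fin addr_ge0// ltW.
by under eq_integral do rewrite /D' sqrrN.
Qed.

End MeanSquareLimit.

(** * The precision matrix *)

Section PrecisionFlux.
Context {R : realType} (G : metric_graph R) (kappa tau : R).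
Hypothesis kappa0 : 0 < kappa.
Hypothesis glen0 : forall e : gedge G, 0 < glen e.
Context (a b : gedge G -> R).
Hypothesis glenE : forall e, glen e = b e - a e.
Context (c : gvert G -> R).

Let ab e : a e < b e. Proof. by rewrite -subr_gt0 -glenE. Qed.

Local Notation q := (decay a b kappa).
Local Notation sl_src := (slope_src a b (@gsrc R G) (@gtgt R G) kappa c).
Local Notation sl_tgt := (slope_tgt a b (@gsrc R G) (@gtgt R G) kappa c).
Local Notation fluxE := (flux a b (@gsrc R G) (@gtgt R G) kappa c).

Lemma expR_decay e : expR (- kappa * glen e) = q e.
Proof. by rewrite /decay glenE. Qed.

Lemma expR2_decay e : expR (- 2 * kappa * glen e) = q e ^+ 2.
Proof. by rewrite -expR_decay expr2 -expRD; congr expR; ring. Qed.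

Lemma tanh_decay e : tanh (kappa * glen e / 2) = (1 - q e) / (1 + q e).
Proof.
rewrite /tanh -expR_decay.
have -> : - kappa * glen e = - (kappa * glen e / 2) + - (kappa * glen e / 2) by field.
set y := kappa * glen e / 2.
have e0 : expR (- y) != 0 by rewrite gt_eqF// expR_gt0.
have -> : expR y = (expR (- y))^-1 by rewrite -expRN opprK.
rewrite expRD; set z := expR (- y) in e0 *.
have z0 : 0 < z by exact: expR_gt0.
have z1 : 1 + z * z != 0 by rewrite gt_eqF// addr_gt0// mulr_gt0.
have z2 : z^-1 + z != 0 by rewrite gt_eqF// addr_gt0// invr_gt0.
by field; rewrite z1 e0.
Qed.

(** The contribution of one edge to row [x] of the product. On a loop both slopes coincide and add
    up to -2 kappa (1 - q)^2 / (1 - q^2) c(x), and (1 - q) / (1 + q) = tanh(kappa l / 2); this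
    explains the separate loop term of the matrix, counted once. *)
Lemma edge_flux e (x : gvert G) :
  2 * kappa * tau ^+ 2 * (if incident e x then
     ((2^-1 + q e ^+ 2 / (1 - q e ^+ 2)) * (gtgt e != gsrc e)%:R
      + (1 - q e) / (1 + q e) * (gtgt e == gsrc e)%:R) else 0) * c x
  + \sum_(y | y != x) - (2 * kappa * tau ^+ 2) *
      (if incident e x && incident e y then q e / (1 - q e ^+ 2) else 0) * c y
  = tau ^+ 2 * ((if gsrc e == x then - sl_src e else 0) +
                (if gtgt e == x then - sl_tgt e else 0)).
Proof.
have /andP[q0 q1] := decay_bounds ab kappa0 e.
have n1 : 1 - q e ^+ 2 != 0.
  by rewrite gt_eqF// subr_gt0 expr_lt1// ltW.
have n2 : 1 + q e != 0 by rewrite gt_eqF// addr_gt0.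
rewrite (slope_srcE _ _ ab kappa0) (slope_tgtE _ _ ab kappa0).
rewrite /incident.
have sum0 : ~~ ((gsrc e == x) || (gtgt e == x)) ->
    \sum_(y | y != x) - (2 * kappa * tau ^+ 2) *
      (if ((gsrc e == x) || (gtgt e == x)) && ((gsrc e == y) || (gtgt e == y))
       then q e / (1 - q e ^+ 2) else 0) * c y = 0.
  by move=> /negbTE ->; apply: big1 => y _; rewrite mulr0 mul0r.
have sum1 z : (gsrc e == x) || (gtgt e == x) -> z != x ->
    (forall y, y != x -> ((gsrc e == y) || (gtgt e == y)) = (y == z)) ->
    \sum_(y | y != x) - (2 * kappa * tau ^+ 2) *
      (if ((gsrc e == x) || (gtgt e == x)) && ((gsrc e == y) || (gtgt e == y))
       then q e / (1 - q e ^+ 2) else 0) * c y =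
    - (2 * kappa * tau ^+ 2) * (q e / (1 - q e ^+ 2)) * c z.
  move=> -> zx hz; rewrite (bigD1 z)//= hz// eqxx big1 ?addr0// => y /andP[yx yz].
  by rewrite hz// (negbTE yz) mulr0 mul0r.
have sum2 : gsrc e = x -> gtgt e = x ->
    \sum_(y | y != x) - (2 * kappa * tau ^+ 2) *
      (if ((gsrc e == x) || (gtgt e == x)) && ((gsrc e == y) || (gtgt e == y))
       then q e / (1 - q e ^+ 2) else 0) * c y = 0.
  move=> -> ->; apply: big1 => y yx.
  by rewrite eqxx [x == y]eq_sym (negbTE yx) mulr0 mul0r.
move: sum0 sum1 sum2; set S := \sum_(y | y != x) _ => sum0 sum1 sum2.
have [sx|sx] := eqVneq (gsrc e) x; have [tx|tx] := eqVneq (gtgt e) x.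
- rewrite sum2// sx tx eqxx/= mulr0 mulr1 add0r.
  by field; rewrite n2 n1.
- rewrite (sum1 (gtgt e)) ?sx ?eqxx// => [|y yx]; last first.
    by rewrite [x == y]eq_sym (negbTE yx) eq_sym.
  by rewrite /= (negbTE tx) /= mulr0 mulr1 !addr0; field.
- rewrite (sum1 (gsrc e)) ?tx ?eqxx ?orbT// => [|y yx]; last first.
    by rewrite [x == y]eq_sym (negbTE yx) orbF eq_sym.
  by rewrite /= [x == gsrc e]eq_sym (negbTE sx) /= mulr0 mulr1 !(addr0, add0r); field.
- by rewrite sum0 ?negb_or ?sx//=; ring.
Qed.

Lemma precision_mx_flux (N : nat) (w : 'I_N -> gvert G) (i : 'I_N) :
  bijective w ->
  \sum_j precision_mx kappa tau w i j * c (w j) = tau ^+ 2 * fluxE (w i).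
Proof.
move=> bw; have injw := bij_inj bw.
pose Qf x y := if x == y then 2 * kappa * tau ^+ 2 * \sum_(e | incident e x)
        ((2^-1 + q e ^+ 2 / (1 - q e ^+ 2)) * (gtgt e != gsrc e)%:R
         + (1 - q e) / (1 + q e) * (gtgt e == gsrc e)%:R)
    else - (2 * kappa * tau ^+ 2) *
        \sum_(e | incident e x && incident e y) q e / (1 - q e ^+ 2).
have QE j : precision_mx kappa tau w i j = Qf (w i) (w j).
  rewrite mxE /Qf (inj_eq injw); case: ifP => _; congr (_ * _);
    apply: eq_bigr => e _.
    by rewrite expR2_decay tanh_decay.
  by rewrite expR2_decay expR_decay.
under eq_bigr do rewrite QE.
have [g wK gK] := bw.
transitivity (\sum_y Qf (w i) y * c y).
  by rewrite (reindex w)//; exists g => y _; [exact: wK|exact: gK].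
rewrite (bigD1 (w i))//= {1}/Qf eqxx; set x := w i.
transitivity (\sum_e tau ^+ 2 * ((if gsrc e == x then - sl_src e else 0) +
                (if gtgt e == x then - sl_tgt e else 0))); last first.
  rewrite -mulr_sumr big_split/= /flux; congr (_ * (_ + _)).
    by rewrite [RHS]big_mkcond.
  by rewrite [RHS]big_mkcond.
under [RHS]eq_bigr do rewrite -edge_flux.
rewrite [RHS]big_split/=; congr (_ + _).
  by rewrite big_mkcond mulr_sumr mulr_suml.
rewrite [RHS]exchange_big/=; apply: eq_bigr => y yx.
rewrite /Qf [x == y]eq_sym (negbTE yx) big_mkcond mulr_sumr mulr_suml.
by apply: eq_bigr => e _.
Qed.

Lemma flux_dot_eq0 : \sum_v fluxE v * c v <= 0 ->
  forall e, c (gsrc e) = 0 /\ c (gtgt e) = 0.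
Proof.
rewrite flux_dot => le0.
(* kappa tanh(kappa l / 2) is the smaller eigenvalue of the quadratic form of one edge, attained at
   equal end values: the form minus this multiple of s^2 + t^2 is a multiple of (s - t)^2. *)
pose k e := kappa * ((1 - q e) / (1 + q e)).
have k0 e : 0 < k e.
  have /andP[q0 q1] := decay_bounds ab kappa0 e.
  by rewrite mulr_gt0// divr_gt0 ?subr_gt0// addr_gt0.
have lb e : k e * (c (gsrc e) ^+ 2 + c (gtgt e) ^+ 2) <=
    - sl_src e * c (gsrc e) + - sl_tgt e * c (gtgt e).
  have /andP[q0 q1] := decay_bounds ab kappa0 e.
  have n1 : 0 < 1 - q e ^+ 2 by rewrite subr_gt0 expr_lt1// ltW.
  rewrite (slope_srcE _ _ ab kappa0) (slope_tgtE _ _ ab kappa0).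
  rewrite -subr_ge0.
  set s := c (gsrc e); set t := c (gtgt e).
  have n1' : 1 - q e ^+ 2 != 0 by rewrite gt_eqF.
  have n2 : 1 + q e != 0 by rewrite gt_eqF// addr_gt0.
  rewrite (_ : _ - _ = kappa * (2 * q e) * (s - t) ^+ 2 / (1 - q e ^+ 2)).
    by rewrite divr_ge0 ?(ltW n1)// mulr_ge0 ?sqr_ge0// !mulr_ge0 ?ltW.
  by rewrite /k; field; rewrite n1' n2.
have nn e : 0 <= k e * (c (gsrc e) ^+ 2 + c (gtgt e) ^+ 2).
  by rewrite mulr_ge0 ?addr_ge0 ?sqr_ge0// ltW.
have : \sum_e k e * (c (gsrc e) ^+ 2 + c (gtgt e) ^+ 2) == 0.
  rewrite eq_le sumr_ge0// andbT; apply: le_trans le0.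
  by apply: ler_sum => e _; exact: lb.
rewrite psumr_eq0// => /allP h e.
have := h e (mem_index_enum _); rewrite /= mulf_eq0 gt_eqF//= paddr_eq0 ?sqr_ge0//.
by rewrite !sqrf_eq0 => /andP[/eqP-> /eqP->].
Qed.

End PrecisionFlux.

(** * Quadratic forms and Schur complements *)

Section SchurComplement.
Context {R : realType} {m n : nat}.

Lemma symm_quadratic_eq (N : nat) (A B : 'M[R]_N) : A^T = A -> B^T = B ->
  (forall x : 'cV[R]_N, (x^T *m A *m x) 0 0 = (x^T *m B *m x) 0 0) -> A = B.
Proof.
move=> At Bt h; have [D DE] : exists D, D = A - B by exists (A - B).
have Dt : D^T = D by rewrite DE linearB /= At Bt.
have D0 (x : 'cV[R]_N) : (x^T *m D *m x) 0 0 = 0.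
  rewrite DE mulmxBr mulmxBl mxE [X in _ + X]mxE.
  apply/eqP; rewrite subr_eq0; apply/eqP; exact: h.
have bil (M : 'M[R]_N) i j :
    ((delta_mx i 0 : 'cV_N)^T *m M *m (delta_mx j 0 : 'cV_N)) 0 0 = M i j.
  by rewrite trmx_delta -rowE -colE !mxE.
apply/matrixP => i j; apply/eqP; rewrite -subr_eq0; apply/eqP.
have := D0 (delta_mx i 0 + delta_mx j 0).
have addE (M M' : 'M[R]_1) : (M + M') 0 0 = M 0 0 + M' 0 0 by rewrite mxE.
rewrite [(_ + _)^T]raddfD /= !mulmxDl !mulmxDr !addE !bil.
have Dii k : D k k = 0 by rewrite -(bil D) D0.
have Dji : D j i = D i j by rewrite -{1}Dt mxE.
rewrite !Dii Dji add0r addr0 => DD.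
have : D i j = A i j - B i j by rewrite DE !mxE.
by move=> <-; lra.
Qed.

(** A kernel vector of the upper left block, padded with zeros, has quadratic form 0, so that block
    is invertible. Eliminating the upper right block of [S] from the second block column of Q S = 1
    leaves Qs times the lower right block of [S], equal to 1. *)
Lemma schur_posdef (Q S : 'M[R]_(m + n)) :
  (forall x : 'cV[R]_(m + n), (x^T *m Q *m x) 0 0 <= 0 -> x = 0) ->
  Q *m S = 1%:M ->
  let Qs := drsubmx Q - dlsubmx Q *m invmx (ulsubmx Q) *m ursubmx Q in
  [/\ ulsubmx Q \in unitmx, Qs \in unitmx & invmx Qs = drsubmx S].
Proof.
move=> pd QS /=; set A := ulsubmx Q; set B := ursubmx Q.
set C := dlsubmx Q; set D := drsubmx Q; set Qs := D - _.
have QE : Q = block_mx A B C D by rewrite submxK.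
have uU : A \in unitmx.
  rewrite -row_free_unit -kermx_eq0; apply/rowV0P => v /sub_kermxP vA.
  have /eqP : col_mx v^T 0 = 0 :> 'cV_(m + n).
    apply: pd; rewrite QE tr_col_mx trmxK trmx0 mul_row_block vA !mul0mx !addr0.
    by rewrite mul_row_col mul0mx mulmx0 addr0 mxE.
  by rewrite col_mx_eq0 => /andP[/eqP/(congr1 trmx)]; rewrite trmxK trmx0.
have QsS : Qs *m drsubmx S = 1%:M.
  have := QS; rewrite QE -[S]submxK mulmx_block -[1%:M]submxK => /eq_block_mx[_ h1 _ h2].
  have ur0 : ursubmx (1%:M : 'M[R]_(m + n)) = 0 by rewrite scalar_mx_block block_mxKur.
  have dr1 : drsubmx (1%:M : 'M[R]_(m + n)) = 1%:M by rewrite scalar_mx_block block_mxKdr.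
  rewrite ur0 in h1; rewrite dr1 in h2; rewrite block_mxKdr.
  rewrite /Qs mulmxBl -!mulmxA.
  have -> : B *m drsubmx S = - (A *m ursubmx S).
    by apply/eqP; rewrite -addr_eq0 addrC h1.
  by rewrite !mulmxN mulKmx// opprK addrC h2.
have [uQs _] := mulmx1_unit QsS.
by split => //; rewrite -[LHS]mulmx1 -QsS mulKmx.
Qed.

End SchurComplement.

(** * The law of the solution at the vertices *)

Section Incidence.
Context {R : realType} (G : metric_graph R) (n : nat) (s : 'I_n -> point G).
Hypothesis cG : compact_metric_graph G.

Let glen0 (e : gedge G) : 0 < glen e. Proof. by case: cG. Qed.

Lemma edge_at_vertex (v : gvert G) : exists e : gedge G, gsrc e = v \/ gtgt e = v.
Proof.
have [/card_gt0P[e0 _] _ conn] := cG.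
have /connectP[[|y p] /=] := conn v (gsrc e0); first by move=> _ ev; exists e0; left.
by move=> /andP[/existsP[e /orP[/andP[/eqP h _]|/andP[_ /eqP h]]] _] _; exists e; auto.
Qed.

(** Needed for definiteness of the matrix: [flux_dot_eq0] only kills the values of [c] at ends of
    pieces. *)
Lemma piece_at_vertex (v : gvert (extended_graph s)) :
  exists i : gedge (extended_graph s), gsrc i = v \/ gtgt i = v.
Proof.
case E : (ssval v) => [v0|p].
  have [e [ev|ev]] := edge_at_vertex v0.
    exists (@piece _ _ _ s e ord0); left; apply: val_inj => /=.
    by rewrite E -ev; exact: pt_src.
  exists (@piece _ _ _ s e ord_max); right; apply: val_inj => /=.
  by rewrite E -ev breakpoint_last; exact: pt_tgt.
have : inr p \in codom s.
  have := ssvalP v; rewrite E mem_cat => /orP[/mapP[]//|//].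
move=> ps; set e := (val p).1; set t := (val p).2.
have tc : t \in cuts s e.
  by rewrite mem_sort mem_undup mem_pmap; apply/mapP; exists (inr p); rewrite //= eqxx.
(* Breakpoints are shifted by one against [cuts], since 0 comes first; so the piece whose number is
   the index of [t] ends at [t]. *)
have jlt : (index t (cuts s e) < (size (cuts s e)).+1)%N.
  by rewrite ltnS ltnW// index_mem.
exists (@piece _ _ _ s e (Ordinal jlt)); right; apply: val_inj => /=.
have -> : breakpoint s e (index t (cuts s e)).+1 = t.
  by rewrite /breakpoint /= nth_rcons index_mem tc nth_index.
rewrite E /pt; case: insubP => [p' _ p'E|]; last by rewrite /=; have := valP p => /= ->.
by congr inr; apply: val_inj; rewrite p'E -surjective_pairing.
Qed.

End Incidence.

Section Variance.
Context {R : realType} (G : metric_graph R) (kappa tau : R)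
  (d : measure_display) (T : measurableType d) (P : probability T R)
  (W : (gedge G -> R -> R) -> T -> R) (u : point G -> T -> R)
  (n : nat) (s : 'I_n -> point G).
Hypothesis cG : compact_metric_graph G.
Hypothesis kappa0 : 0 < kappa.
Hypothesis wn : white_noise P W.
Hypothesis sol : whittle_matern_solution kappa tau P W u.

Local Notation EG := (extended_graph s).
Local Notation pl := (@piece_lo _ _ _ s).
Local Notation ph := (@piece_hi _ _ _ s).
Local Notation ipE := (ip pl ph).
Local Notation domE := (dom pl ph (@gsrc _ EG) (@gtgt _ EG)).

Let glen0 (e : gedge G) : 0 < glen e. Proof. by case: cG. Qed.

Lemma white_noise_measurable h : L2 h -> measurable_fun setT (W h).
Proof.
move=> h2; have [/(_ 1%N (fun=> h) (fun=> h2))[Sg [_ /(_ (\col_i 1))[mW _ _]]] _] := wn.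
by move: mW; under eq_fun do rewrite big_ord1 mxE mul1r.
Qed.

Lemma white_noise_sqr h : L2 h ->
  (\int[P]_om ((W h om) ^+ 2)%:E = (L2_inner h h)%:E)%E.
Proof.
move=> h2; have [_ /(_ h h h2 h2)] := wn; rewrite unlock => <-.
by apply: eq_integral => om _; rewrite expr2.
Qed.

(** The variable [Z] stands in for (u, L g): as a value of the white noise it is measurable with
    known second moment, whereas the pathwise product is only known to agree with it almost
    surely. *)
Lemma solution_test g g1 g2 : domE g g1 g2 ->
  exists Z : T -> R, [/\ measurable_fun setT Z,
    (\int[P]_om ((Z om) ^+ 2)%:E = (tau ^- 2 * ipE (Lop kappa g g2) g)%:E)%E
  & {ae P, forall om,
      ipE (fun i => restr (fun x => u x om) (piece_edge i)) (Lop kappa g g2) = Z om}].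
Proof.
move=> dg; have cLg := pcont_Lop (kappa := kappa) dg.
have gl2 := L2_glue glen0 cLg.
have [_ cu /(_ _ gl2)[f pf uW]] := sol.
have [lam [psi [_ f2 _]]] := pf.
have tf2 : L2 (fun e t => tau^-1 * f e t) by exact: L2Z.
exists (W (fun e t => tau^-1 * f e t)); split.
- exact: white_noise_measurable.
- rewrite white_noise_sqr// L2_innerZl// L2_innerC L2_innerZl//.
  by rewrite (whittle_pow_norm glen0 kappa0 dg pf) mulrA -expr2 exprVn.
- move: cu uW; apply: filterS2 => om cu <-.
  by rewrite L2_inner_glue.
Qed.

Let pcont_path om : graph_continuous (fun x => u x om) ->
  pcont pl ph (fun i => restr (fun x => u x om) (piece_edge i)).
Proof.
move=> cu i; apply: (within_continuousS _ _ (cu (piece_edge i))).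
  exact: piece_lo_ge0.
exact: piece_hi_le.
Qed.

Lemma solution_variance (c : gvert EG -> R)
    (fl := flux pl ph (@gsrc _ EG) (@gtgt _ EG) kappa c)
    (X := fun om => \sum_v fl v * u (ext_point v) om) :
  measurable_fun setT X ->
  (\int[P]_om ((X om) ^+ 2)%:E = (tau ^- 2 * \sum_v fl v * c v)%:E)%E.
Proof.
move=> mX; have ab := @piece_lo_lt_hi _ _ _ s glen0.
pose te k := test pl ph (@gsrc _ EG) (@gtgt _ EG) kappa c k.
pose te2 k := test2 pl ph (@gsrc _ EG) (@gtgt _ EG) kappa c k.
have dte k : domE (te k) _ (te2 k) := dom_test (@gsrc _ EG) (@gtgt _ EG) ab kappa0 c k.
have [Z hZ] := choice (fun k => solution_test (dte k)).
have cLt k := pcont_Lop (kappa := kappa) (dte k).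
have [_ cu _] := sol.
pose V k := ipE (Lop kappa (te k) (te2 k)) (te k).
have [C hC] := energy_test_sub (@gsrc _ EG) (@gtgt _ EG) ab kappa0 c.
apply: (@mean_square_limit _ _ _ _ X Z (fun k => tau ^- 2 * V k) _ (tau ^- 2 * C)).
- exact: mX.
- by move=> k; have [] := hZ k.
- have hae : \forall om \ae P, forall k,
      ipE (fun i => restr (fun x => u x om) (piece_edge i))
        (Lop kappa (te k) (te2 k)) = Z k om.
    by apply/ae_foralln => k; have [] := hZ k.
  move: cu hae; apply: filterS2 => om cu hk.
  have -> : Z ^~ om = (fun k => ipE (Lop kappa (te k) (te2 k))
       (fun i => restr (fun x => u x om) (piece_edge i))).
    by apply/funext => k; rewrite -hk ipC.
  apply: (ip_test_cvg_flux ab (val := fun v => u (ext_point v) om)).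
    exact: pcont_path.
  by move=> i; split.
- by move=> k; have [] := hZ k.
- by apply: cvgMl_tmp; exact: (energy_test_cvg ab kappa0).
(* [solution_test] is applied afresh to the difference of two test functions. Its variable agrees
   almost surely with Z_k - Z_m because the pathwise products are linear, so the two powers of L
   need not be compared. *)
- move=> k m; have dkm := dom_lin (-1) (dte k) (dte m).
  have [Z' [mZ' EZ' aeZ']] := solution_test dkm.
  have mZ j : measurable_fun setT (Z j) by have [] := hZ j.
  have <- : (\int[P]_om ((Z' om) ^+ 2)%:E = \int[P]_om ((Z k om + - Z m om) ^+ 2)%:E)%E.
    apply: ge0_ae_eq_integral => //.
    + by apply/measurable_EFinP; exact: measurable_funX.
    + by apply/measurable_EFinP; apply: measurable_funX; exact: measurable_funB.
    + by move=> x _; rewrite lee_fin sqr_ge0.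
    + by move=> x _; rewrite lee_fin sqr_ge0.
    have [_ _ aek] := hZ k; have [_ _ aem] := hZ m.
    have cuZ' : \forall om \ae P,
        pcont pl ph (fun i => restr (fun x => u x om) (piece_edge i)) /\
        ipE (fun i => restr (fun x => u x om) (piece_edge i))
          (Lop kappa (fun i t => te k i t + -1 * te m i t)
             (fun i t => te2 k i t + -1 * te2 m i t)) = Z' om.
      by move: cu aeZ'; apply: filterS2 => om cu ->; split => //; exact: pcont_path.
    move: cuZ' aek aem; apply: filterS3 => om [cup <-] <- <- _.
    congr (_ ^+ 2)%:E.
    have cz : pcont pl ph (fun i t => -1 * Lop kappa (te m) (te2 m) i t) by exact: pcontZ.
    rewrite -[X in _ = _ + X]mulN1r -(ipZr _ (@cLt m) cup) -(ipDr (@cLt k) cz cup).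
    by apply: eq_ip => // i t _; rewrite /Lop; ring.
  rewrite EZ' lee_fin -mulrA; apply: ler_wpM2l; last exact: hC.
  by rewrite invr_ge0 sqr_ge0.
Qed.

End Variance.

Lemma precision_mx_sym (R : realType) (G : metric_graph R) (kappa tau : R)
    (N : nat) (w : 'I_N -> gvert G) :
  (precision_mx kappa tau w)^T = precision_mx kappa tau w.
Proof.
apply/matrixP => i j; rewrite !mxE eq_sym; case: eqP => [->//|_].
by congr (_ * _); apply: eq_bigl => e; rewrite andbC.
Qed.

Lemma gaussian_vector_drsub (R : realType) (d : measure_display)
    (T : measurableType d) (P : probability T R) (m n : nat)
    (X : 'I_(m + n) -> T -> R) (S : 'M[R]_(m + n)) :
  gaussian_vector P X 0 S ->
  gaussian_vector P (fun i => X (rshift m i)) 0 (drsubmx S).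
Proof.
move=> [St h]; split; first by rewrite trmx_drsub St.
move=> a; have := h (col_mx 0 a).
rewrite tr_col_mx trmx0 mulmx0 -{1}[S]submxK mul_row_block !mul0mx !add0r.
rewrite mul_row_col mulmx0 add0r mulmx0.
have -> : (fun om => \sum_i (col_mx 0 a : 'cV[R]_(m + n)) i 0 * X i om) =
    (fun om => \sum_i a i 0 * X (rshift m i) om).
  apply/funext => om; rewrite big_split_ord/= big1 ?add0r => [|i _].
    by apply: eq_bigr => i _; rewrite col_mxEd.
  by rewrite col_mxEu mxE mul0r.
by [].
Qed.

Theorem corollary5 (R : realType) (G : metric_graph R) (kappa tau : R)
    (d : measure_display) (T : measurableType d) (P : probability T R)
    (W : (gedge G -> R -> R) -> T -> R) (u : point G -> T -> R)
    (n : nat) (s : 'I_n -> point G)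
    (m : nat) (w : 'I_(m + n) -> gvert (extended_graph s)) :
  compact_metric_graph G -> 0 < kappa -> 0 < tau ->
  white_noise P W -> whittle_matern_solution kappa tau P W u ->
  injective s ->
  bijective w -> (forall i : 'I_n, ext_point (w (rshift m i)) = s i) ->
  let Q : 'M[R]_(m + n) := precision_mx kappa tau w in
  let Qvv := ulsubmx Q in
  let Qvs := ursubmx Q in
  let Qsv := dlsubmx Q in
  let Qss := drsubmx Q in
  let Qs := Qss - Qsv *m invmx Qvv *m Qvs in
  [/\ Qvv \in unitmx, Qs \in unitmx
    & gaussian_vector P (fun i => u (s i)) 0 (invmx Qs)].
Proof.
move=> cG kappa0 tau0 wn sol _ bw ws Q.
have glen0 (e : gedge G) : 0 < glen e by case: cG.
have [g wK gK] := bw.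
have sumw (F : gvert (extended_graph s) -> R) : \sum_i F (w i) = \sum_v F v.
  by rewrite [RHS](reindex w)//; exists g => y _; [exact: wK|exact: gK].
pose EG := extended_graph s.
pose c (C : 'cV[R]_(m + n)) (v : gvert EG) := C (g v) 0.
pose fl C := flux (@piece_lo _ _ _ s) (@piece_hi _ _ _ s) (@gsrc _ EG) (@gtgt _ EG)
  kappa (c C).
have elen0 (e : gedge EG) : 0 < glen e by rewrite subr_gt0; exact: piece_lo_lt_hi.
have elenE (e : gedge EG) : glen e = piece_hi e - piece_lo e by [].
have QC C i : (Q *m C) i 0 = tau ^+ 2 * fl C (w i).
  rewrite -(precision_mx_flux tau kappa0 elen0 elenE (c C) i bw) mxE.
  by apply: eq_bigr => j _; rewrite /c wK.
have quad C : (C^T *m Q *m C) 0 0 = tau ^+ 2 * \sum_v fl C v * c C v.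
  rewrite -mulmxA mxE -sumw mulr_sumr; apply: eq_bigr => i _.
  by rewrite QC mxE /c wK; ring.
have pdQ (C : 'cV[R]_(m + n)) : (C^T *m Q *m C) 0 0 <= 0 -> C = 0.
  rewrite quad pmulr_rle0 ?exprn_gt0// => le0.
  have h := flux_dot_eq0 kappa0 elen0 elenE le0.
  apply/matrixP => i j; rewrite ord1 mxE -(wK i) -/(c C (w i)).
  by have [e [<-|<-]] := piece_at_vertex cG (w i); have [h1 h2] := h e.
have Qt : Q^T = Q by exact: precision_mx_sym.
have [gauss _ _] := sol.
have [S gS] := gauss (m + n)%N (fun k => ext_point (w k)) (fun=> I).
have [St gauS] := gS.
have QSQ : Q *m S *m Q = Q.
  (* The combination with weights [a] = tau^-2 Q C has variance a^T S a by Gaussianity and tau^-2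
     times the flux pairing by [solution_variance]. Up to the common factor tau^-4 these are the
     quadratic forms of Q S Q and Q at [C]. *)
  apply: symm_quadratic_eq => //; first by rewrite !trmx_mul Qt St mulmxA.
  move=> C; pose a := tau ^- 2 *: (Q *m C).
  have aE i : a i 0 = fl C (w i).
    by rewrite mxE QC mulrA mulVf ?mul1r// expf_neq0// gt_eqF.
  have := gauS a; rewrite mulmx0 mxE.
  have -> : (fun om => \sum_i a i 0 * u (ext_point (w i)) om) =
      (fun om => \sum_v fl C v * u (ext_point v) om).
    apply/funext => om; rewrite -(sumw (fun v => fl C v * u (ext_point v) om)).
    by apply: eq_bigr => i _; rewrite aE.
  move=> gX; have [mX v0 _] := gX.
  have := integral_sqr_normal_law v0 gX.
  rewrite (solution_variance cG kappa0 wn sol mX) => -[].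
  have -> : \sum_v fl C v * c C v = tau ^- 2 * (C^T *m Q *m C) 0 0.
    by rewrite quad mulrA mulVf ?mul1r// expf_neq0// gt_eqF.
  have -> : a^T *m S *m a = (tau ^- 2 * tau ^- 2) *: (C^T *m (Q *m S *m Q) *m C).
    have -> : a^T = tau ^- 2 *: (C^T *m Q).
      by rewrite /a [(_ *: _)^T]linearZ /= trmx_mul Qt.
    rewrite /a -scalemxAl -scalemxAl -scalemxAr scalerA.
    by rewrite !mulmxA.
  rewrite [RHS]mxE mulrA => /mulfI ->//.
  by rewrite mulf_neq0// invr_neq0// expf_neq0// gt_eqF.
have uQ : Q \in unitmx.
  rewrite -row_free_unit -kermx_eq0; apply/rowV0P => v /sub_kermxP vQ.
  have := pdQ v^T; rewrite trmxK vQ mul0mx mxE lexx => /(_ isT) /(congr1 trmx).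
  by rewrite trmxK trmx0.
have QS : Q *m S = 1%:M.
  by rewrite -[LHS]mulmx1 -(mulmxV uQ) mulmxA QSQ.
have [uvv uQs SE] := schur_posdef pdQ QS.
split => //; rewrite SE.
have -> : (fun i => u (s i)) = (fun i => u (ext_point (w (rshift m i)))).
  by apply/funext => i; rewrite ws.
exact: (gaussian_vector_drsub gS).
Qed.
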